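(* Let $N\ge 2$ be an integer. The space $\Omega_N^{\mathbb{C}}\times\mathcal{A}^{\mathbb{C}}$ of discrete Sturm-Liouville problems is a connected complex manifold of complex dimension $3N+5$, while the space $\Omega_N^{\mathbb{R},+}\times\mathcal{B}^{\mathbb{C}}$ of self-adjoint discrete Sturm-Liouville problems is a real-analytic manifold of dimension $3N+5$ and has $2^{N+1}$ connected components.
   Context: $\Omega_N^{\mathbb{C}}$ is the set of triples $(1/f,q,w)$, where $1/f=(1/f_0,\dots,1/f_N)$, $q=(q_1,\dots,q_N)$, $w=(w_1,\dots,w_N)$ are complex sequences with $f_n\neq 0$ for $0\le n\le N$ and $w_n\ne 0$ for $1\le n\le N$; it is an open subset of $\mathbb{C}^{3N+1}$ with the induced topology and structure. $\Omega_N^{\mathbb{R},+}$ is the set of those triples whose entries are all real and with $w_n>0$ for $1\le n\le N$; it is an open subset of $\mathbb{R}^{3N+1}$. $\mathcal{A}^{\mathbb{C}}$, the space of boundary conditions, is the quotient space $M^*_{2,4}(\mathbb{C})/GL(2,\mathbb{C})$ with the quotient topology, where $M^*_{2,4}(\mathbb{C})$ is the set of complex $2\times4$ matrices $(A,B)$ ($A,B$ being $2\times2$) of rank $2$, and $T\in GL(2,\mathbb{C})$ acts by $(A,B)\mapsto(TA,TB)$. The class of $(A,B)$ is denoted $[A\,|\,B]$. The complex manifold structure on $\mathcal{A}^{\mathbb{C}}$ is given by the six charts $\mathcal{N}_{i,j}^{\mathbb{C}}$, $1\le i<j\le 4$, where $\mathcal{N}_{i,j}^{\mathbb{C}}$ is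 the set of classes having a representative $(A,B)$ whose columns $i,j$ are fixed as follows and whose other four entries are arbitrary complex numbers, used as coordinates: columns $(1,2)$ equal to $(1,0)^t,(0,1)^t$; columns $(1,3)$ equal to $(1,0)^t,(0,-1)^t$; columns $(1,4)$ equal to $(1,0)^t,(0,1)^t$; columns $(2,3)$ equal to $(-1,0)^t,(0,-1)^t$; columns $(2,4)$ equal to $(-1,0)^t,(0,1)^t$; columns $(3,4)$ equal to $(-1,0)^t,(0,-1)^t$. A boundary condition $[A\,|\,B]$ is self-adjoint if $AEA^*=BEB^*$, where $E=\begin{pmatrix}0&1\\-1&0\end{pmatrix}$ and $A^*$ is the conjugate transpose. $\mathcal{B}^{\mathbb{C}}\subset\mathcal{A}^{\mathbb{C}}$ is the subspace of self-adjoint boundary conditions. Its real-analytic structure is given by the four charts (with two real parameters and one complex parameter $z$, identified with two real coordinates) $$\mathcal{O}_{1,3}^{\mathbb{C}}=\left\{\left[\begin{array}{cccc}1&a_{12}&0&\bar z\\0&z&-1&b_{22}\end{array}\right]\right\},\quad \mathcal{O}_{1,4}^{\mathbb{C}}=\left\{\left[\begin{array}{cccc}1&a_{12}&\bar z&0\\0&z&b_{21}&1\end{array}\right]\right\},$$ $$\mathcal{O}_{2,3}^{\mathbb{C}}=\left\{\left[\begin{array}{cccc}a_{11}&-1&0&\bar z\\ z&0&-1&b_{22}\end{array}\right]\right\},\quad \mathcal{O}_{2,4}^{\mathbb{C}}=\left\{\left[\begin{array}{cccc}a_{11}&-1&\bar z&0\\ z&0&b_{21}&1\end{array}\right]\right\}.$$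 Product spaces carry the product structures. *)

(* Defs.v *)
From HB Require Import structures.
From mathcomp Require Import all_boot all_order all_algebra.
From mathcomp Require Import all_classical all_reals all_analysis.
From mathcomp Require Import generic_quotient complex.
From mathcomp.analysis.showcase Require summability.

Set Implicit Arguments.
Unset Strict Implicit.
Unset Printing Implicit Defensive.

Import Order.TTheory GRing.Theory Num.Theory.
Import numFieldNormedType.Exports.

Local Open Scope classical_set_scope.
Local Open Scope ring_scope.

(* R[i], packed as a numClosedFieldType: the library puts its norm topology
   on abstract number fields, not on the bare type [complex R]. *)
Definition Cplx (R : realType) : numClosedFieldType := R[i].

(* [cmap] is meaningful on [cdom] only.  The dimension is a field of the
   record, so that a propositional equality of dimensions suffices below. *)
Record chart (K M : Type) := Chart {
  cdim : nat ;
  cdom : set M ;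
  cmap : M -> 'rV[K]_cdim
}.

Definition is_chart (K : numFieldType) (M : topologicalType) (c : chart K M) :=
  [/\ open (cdom c),
      open (cmap c @` cdom c),
      {within cdom c, continuous (cmap c)}
    & exists2 g : 'rV[K]_(cdim c) -> M,
        {within cmap c @` cdom c, continuous g}
      & forall x, cdom c x -> g (cmap c x) = x].

(* A class of smoothness for maps defined on open subsets of K^m. *)
Definition smoothness (K : Type) :=
  forall m n : nat, set 'rV[K]_m -> ('rV[K]_m -> 'rV[K]_n) -> Prop.

(* Hausdorff, second countable, with an atlas of charts with values in K^n.
   The map [tau] is the change of charts; it is determined on the open set
   [cmap c @` (cdom c `&` cdom c')], the only place where it is constrained. *)
Definition is_manifold (K : numFieldType) (smooth : smoothness K)
    (M : topologicalType) (atlas : set (chart K M)) (n : nat) :=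
  [/\ hausdorff_space M,
      @second_countable M,
      forall c, atlas c -> cdim c = n /\ is_chart c,
      forall x : M, exists2 c, atlas c & cdom c x
    & forall c c', atlas c -> atlas c' ->
        exists2 tau : 'rV[K]_(cdim c) -> 'rV[K]_(cdim c'),
          smooth _ _ (cmap c @` (cdom c `&` cdom c')) tau
        & forall x, cdom c x -> cdom c' x -> tau (cmap c x) = cmap c' x].

(* Complex (Frechet) differentiability at every point. *)
Definition holomorphic_on (R : realType) : smoothness (Cplx R) :=
  fun m n D f => forall x, D x -> differentiable f x.

(* f is the sum of a convergent power series in n variables around a; the
   family of monomials, indexed by multi-indices, is summed unconditionally
   (hence absolutely), along the filter of finite subsets. *)
Definition real_analytic_at (R : realType) (n : nat) (f : 'rV[R]_n -> R)
    (a : 'rV[R]_n) :=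
  exists (c : {ffun 'I_n -> nat} -> R) (r : R), 0 < r /\
    forall x, ball a r x ->
      summability.partial_sum
        (fun k => c k * \prod_(i < n) (x 0 i - a 0 i) ^+ k i)
        @ summability.totally --> f x.

Definition real_analytic_on (R : realType) : smoothness R :=
  fun m n D f => forall x, D x ->
    forall j : 'I_n, real_analytic_at (fun y => f y 0 j) x.

Definition complex_manifold (R : realType) (M : topologicalType)
    (atlas : set (chart (Cplx R) M)) (n : nat) :=
  is_manifold (@holomorphic_on R) atlas n.

Definition real_analytic_manifold (R : realType) (M : topologicalType)
    (atlas : set (chart R M)) (n : nat) :=
  is_manifold (@real_analytic_on R) atlas n.

Definition prod_chart (K M1 M2 : Type) (c1 : chart K M1) (c2 : chart K M2) :
    chart K (M1 * M2) :=
  Chart (cdom c1 `*` cdom c2)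
        (fun x => row_mx (cmap c1 x.1) (cmap c2 x.2)).

Definition prod_atlas (K M1 M2 : Type)
    (A1 : set (chart K M1)) (A2 : set (chart K M2)) :
    set (chart K (M1 * M2)) :=
  [set prod_chart c1 c2 | c1 in A1 & c2 in A2].

Definition components (M : topologicalType) : set (set M) :=
  [set connected_component [set: M] x | x in [set: M]].
Arguments components : clear implicits.

(* (1/f, q, w); indices of q and w are shifted down by one. *)
Definition triple (K : Type) (N : nat) : Type :=
  'rV[K]_N.+1 * 'rV[K]_N * 'rV[K]_N.

Definition OmegaC (R : realType) (N : nat) : set (triple (Cplx R) N) :=
  [set p : triple (Cplx R) N |
    (exists2 f : 'rV[Cplx R]_N.+1,
       forall n, f 0 n != 0 & p.1.1 = map_mx GRing.inv f)
    /\ forall n : 'I_N, p.2 0 n != 0].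

Definition OmegaRpos (R : realType) (N : nat) : set (triple R N) :=
  [set p : triple R N |
    (exists2 f : 'rV[R]_N.+1,
       forall n, f 0 n != 0 & p.1.1 = map_mx GRing.inv f)
    /\ forall n : 'I_N, 0 < p.2 0 n].
Arguments OmegaC : clear implicits.
Arguments OmegaRpos : clear implicits.

(* The inclusion into K^(3N+1). *)
Definition Omega_chart (K : Type) (N : nat) (Omega : set (triple K N)) :
    chart K Omega :=
  Chart [set: Omega]
    (fun p : Omega => row_mx (row_mx (val p).1.1 (val p).1.2) (val p).2).

Definition Omega_atlas (K : Type) (N : nat) (Omega : set (triple K N)) :
    set (chart K Omega) := [set Omega_chart Omega].
Arguments Omega_atlas {K N} Omega.

(* A pair (A, B) of 2x2 matrices is the matrix [row_mx A B]. *)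
Definition rank2 (R : realType) : set 'M[Cplx R]_(2, 2 + 2) :=
  [set X | \rank X = 2%N].
Arguments rank2 : clear implicits.

Definition GL2_rel (R : realType) : rel (rank2 R) :=
  fun X Y => `[< exists2 T : 'M[Cplx R]_2, T \in unitmx
                                         & val Y = T *m val X >].

Lemma GL2_rel_refl (R : realType) : reflexive (@GL2_rel R).
Proof. by move=> X; apply/asboolP; exists 1%:M; rewrite ?unitmx1 ?mul1mx. Qed.

Lemma GL2_rel_sym (R : realType) : symmetric (@GL2_rel R).
Proof.
suff sub X Y : @GL2_rel R X Y -> GL2_rel Y X.
  by move=> X Y; apply/idP/idP; exact: sub.
move=> /asboolP[T Tu YE]; apply/asboolP; exists (invmx T).
  by rewrite unitmx_inv.
by rewrite YE mulKmx.
Qed.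

Lemma GL2_rel_trans (R : realType) : transitive (@GL2_rel R).
Proof.
move=> Y X Z /asboolP[T Tu YE] /asboolP[S Su ZE]; apply/asboolP.
by exists (S *m T); rewrite ?unitmx_mul ?Su// ZE YE mulmxA.
Qed.

Canonical GL2_equiv (R : realType) : equiv_rel (rank2 R) :=
  EquivRel (@GL2_rel R) (@GL2_rel_refl R) (@GL2_rel_sym R) (@GL2_rel_trans R).

Definition ABC (R : realType) : topologicalType :=
  quotient_topology {eq_quot (GL2_equiv R)}%qT.

Definition bc_class (R : realType) (X : rank2 R) : ABC R :=
  (\pi_(ABC R) X)%qT.

(* p = [A | B], where X = row_mx A B; this forces X to have rank 2. *)
Definition represents (R : realType) (p : ABC R)
    (X : 'M[Cplx R]_(2, 2 + 2)) : Prop :=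
  exists2 Y : rank2 R, val Y = X & bc_class Y = p.

Definition ctr (R : realType) (A : 'M[Cplx R]_2) : 'M[Cplx R]_2 :=
  map_mx Num.conj A^T.

Definition mx24 (K : nzRingType) (r1 r2 : seq K) : 'M[K]_(2, 2 + 2) :=
  \matrix_(i < 2, j < 2 + 2) (if i == 0 then r1 else r2)`_j.

Definition Emx (R : realType) : 'M[Cplx R]_2 :=
  \matrix_(i < 2, j < 2)
    (if i == 0 then [:: 0; 1] else [:: -1; 0] : seq (Cplx R))`_j.

Definition self_adjoint (R : realType) (X : 'M[Cplx R]_(2, 2 + 2)) : Prop :=
  lsubmx X *m Emx R *m ctr (lsubmx X) = rsubmx X *m Emx R *m ctr (rsubmx X).

Definition BBC (R : realType) : set (ABC R) :=
  [set p | exists2 X, represents p X & self_adjoint X].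
Arguments BBC : clear implicits.

(* The chart whose inverse is the parametrization sending v to the element
   of M represented by P v. *)
Definition param_chart (K : nmodType) (n : nat) (M T : Type)
    (rep : M -> T -> Prop) (P : 'rV[K]_n -> T) : chart K M :=
  Chart [set p | exists v, rep p (P v)]
        (fun p => xget 0 [set v | rep p (P v)]).

Section Parametrizations.
Variable R : realType.
Local Notation C := (Cplx R).

Definition N12 (v : 'rV[C]_4) := mx24 [:: 1; 0; v 0 0; v 0 1]
                                      [:: 0; 1; v 0 2; v 0 3].
Definition N13 (v : 'rV[C]_4) := mx24 [:: 1; v 0 0;  0; v 0 1]
                                      [:: 0; v 0 2; -1; v 0 3].
Definition N14 (v : 'rV[C]_4) := mx24 [:: 1; v 0 0; v 0 1; 0]
                                      [:: 0; v 0 2; v 0 3; 1].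
Definition N23 (v : 'rV[C]_4) := mx24 [:: v 0 0; -1;  0; v 0 1]
                                      [:: v 0 2;  0; -1; v 0 3].
Definition N24 (v : 'rV[C]_4) := mx24 [:: v 0 0; -1; v 0 1; 0]
                                      [:: v 0 2;  0; v 0 3; 1].
Definition N34 (v : 'rV[C]_4) := mx24 [:: v 0 0; v 0 1; -1;  0]
                                      [:: v 0 2; v 0 3;  0; -1].

Definition ABC_atlas : set (chart C (ABC R)) :=
  [set param_chart (@represents R) P
    | P in [set N12; N13; N14; N23; N24; N34]].

(* Real coordinates: the two real parameters, then Re z and Im z. *)
Let re (x : R) : C := Complex x 0.
Let z (v : 'rV[R]_4) : C := Complex (v 0 2) (v 0 3).

Definition O13 (v : 'rV[R]_4) := mx24 [:: 1; re (v 0 0);  0; (z v)^*]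
                                      [:: 0; z v; -1; re (v 0 1)].
Definition O14 (v : 'rV[R]_4) := mx24 [:: 1; re (v 0 0); (z v)^*; 0]
                                      [:: 0; z v; re (v 0 1); 1].
Definition O23 (v : 'rV[R]_4) := mx24 [:: re (v 0 0); -1;  0; (z v)^*]
                                      [:: z v;  0; -1; re (v 0 1)].
Definition O24 (v : 'rV[R]_4) := mx24 [:: re (v 0 0); -1; (z v)^*; 0]
                                      [:: z v;  0; re (v 0 1); 1].

Definition BBC_atlas : set (chart R (BBC R)) :=
  [set param_chart (fun p : BBC R => represents (val p)) P
    | P in [set O13; O14; O23; O24]].

End Parametrizations.

Arguments ABC_atlas : clear implicits.
Arguments BBC_atlas : clear implicits.

Definition problems (R : realType) (N : nat) : topologicalType :=
  (OmegaC R N * ABC R)%type.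

Definition problems_atlas (R : realType) (N : nat) :
    set (chart (Cplx R) (problems R N)) :=
  prod_atlas (Omega_atlas (OmegaC R N)) (ABC_atlas R).

Definition sa_problems (R : realType) (N : nat) : topologicalType :=
  (OmegaRpos R N * BBC R)%type.

Definition sa_problems_atlas (R : realType) (N : nat) :
    set (chart R (sa_problems R N)) :=
  prod_atlas (Omega_atlas (OmegaRpos R N)) (BBC_atlas R).
Arguments problems_atlas : clear implicits.
Arguments sa_problems_atlas : clear implicits.

(* Main.v *)
Require Import Defs.
From mathcomp Require Import all_boot all_order all_algebra.
From mathcomp Require Import all_classical all_reals all_analysis.
From mathcomp Require Import generic_quotient complex.
From mathcomp Require Import finmap ring lra zify.

(** The space of boundary conditions is the Grassmannian of planes in [C^4]: a
    class is the row space of a 2x4 matrix of rank 2. The projection onto it is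
    open, since the saturation of an open set is a union of translates, so
    Hausdorffness and second countability come down to a closed equivalence
    relation and to the countable basis of a matrix space
    ([hausdorff_open_quotient], [countable_basis_open_image]). Where the minor
    of two columns does not vanish, a class has exactly one representative whose
    two columns have the prescribed value; its entries are the quotients
    [num / den] of two polynomials in the entries of any representative. All the
    regularity claims follow from this formula: the charts are homeomorphisms
    onto [C^4] and the changes of charts are holomorphic.

    Self-adjoint conditions are Lagrangian planes. By [sa_frames_cover] each of
    them has a nonzero minor mixing a column of [A] with a column of [B]; in
    such a chart self-adjointness is the system of real linear equations
    [sa_framesP], so the real charts are the restrictions of the complex ones,
    and their changes are real and imaginary parts of quotients of complex
    polynomials in real variables. Such functions are sums of power series
    because near a zero of a polynomial [g] the fraction [1 / (1 - g)] is a
    geometric series whose terms, expanded into monomials, are absolutely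
    summable and can be grouped by exponent ([regroup_series],
    [polyfun_div_analytic]).

    The coefficient spaces are open in a vector space. With one global chart in
    this factor and four more coordinates from the boundary condition, the
    dimension is [(N + 1) + N + N + 4 = 3 N + 5] ([prod_manifold]). Each space
    of boundary conditions is connected, because its charts are images of vector
    spaces which share a point. A nonzero complex number is joined to 1 by
    segments that avoid 0, which makes the space of complex problems connected;
    real problems with the same signs of [1 / f_0], ..., [1 / f_N] are joined by
    a segment, and the signs are constant on connected sets, which leaves
    [2 ^ (N + 1)] components. *)

Set Implicit Arguments.
Unset Strict Implicit.
Unset Printing Implicit Defensive.
Import Order.TTheory GRing.Theory Num.Theory.
Import numFieldNormedType.Exports.
Local Open Scope classical_set_scope.
Local Open Scope ring_scope.

(** * Open maps, separation and countable bases *)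

Section Topology.

Lemma hausdorff_inj (T U : topologicalType) (f : T -> U) :
  continuous f -> injective f -> hausdorff_space U -> hausdorff_space T.
Proof.
move=> cf fI hU x y xy; apply/fI/hU => A B nA nB.
have [z [Az Bz]] := xy _ _ (cf _ _ nA) (cf _ _ nB).
by exists (f z).
Qed.

Lemma hausdorff_prod (T U : topologicalType) :
  hausdorff_space T -> hausdorff_space U -> hausdorff_space (T * U)%type.
Proof.
move=> hT hU [x x'] [y y'] xy; congr pair.
  apply: hT => A B nA nB.
  have [[z z'] [Az Bz]] := xy _ _ (@cvg_fst _ _ _ (nbhs x') _ A nA)
    (@cvg_fst _ _ _ (nbhs y') _ B nB).
  by exists z.
apply: hU => A B nA nB.
have [[z z'] [Az Bz]] := xy _ _ (@cvg_snd _ _ (nbhs x) _ _ A nA)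
  (@cvg_snd _ _ (nbhs y) _ _ B nB).
by exists z'.
Qed.

Definition open_fun (T U : topologicalType) (f : T -> U) :=
  forall A, open A -> open (f @` A).

Lemma open_fun_nbhs (T U : topologicalType) (f : T -> U) x A :
  open_fun f -> nbhs x A -> nbhs (f x) (f @` A).
Proof.
rewrite nbhsE => fo [B [oB Bx] BA]; apply: (@filterS _ _ _ (f @` B)).
  by move=> _ [z Bz <-]; exists z => //; exact: BA.
by apply: open_nbhs_nbhs; split; [exact: fo | exists x].
Qed.

(** Openness of [p] turns neighbourhoods of [x] into neighbourhoods of [p x]. *)
Lemma continuous_open_quotient (T U V : topologicalType) (p : T -> U)
  (f : U -> V) (x : T) :
  open_fun p -> {for x, continuous (f \o p)} -> {for p x, continuous f}.
Proof.
move=> po cf A nA; have := open_fun_nbhs po (cf _ nA); apply: filterS.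
by move=> _ [z ? <-].
Qed.

(** A box of unrelated pairs around [(x, x')] has sides which the open
    projection sends to disjoint neighbourhoods of [p x] and [p x']. *)
Lemma hausdorff_open_quotient (T U : topologicalType) (p : T -> U) :
  open_fun p -> (forall y, exists x, p x = y) ->
  open [set q : T * T | p q.1 <> p q.2] -> hausdorff_space U.
Proof.
move=> po ps; rewrite openE => cl.
move=> y y' yy'; apply: contrapT.
have [x xE] := ps y; have [x' xE'] := ps y'; subst y y' => xx'.
have [[A A'] [/= nA nA'] AA'] := cl (x, x') xx'.
have [_ [[z Az <-] [z' Az' zz']]] :=
  yy' _ _ (open_fun_nbhs po nA) (open_fun_nbhs po nA').
by have /= := AA' (z, z') (conj Az Az'); rewrite zz'.
Qed.

(** Second countability with an explicit family indexed by any countable type: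
    products and matrix spaces then just take pairs and matrices of indices. *)
Definition countable_basis (T : topologicalType) :=
  exists (I : countType) (e : I -> set T), (forall i, open (e i)) /\
    forall x A, nbhs x A -> exists2 i, e i x & e i `<=` A.

Lemma countable_basisP (T : topologicalType) :
  countable_basis T -> @second_countable T.
Proof.
move=> [I [e [eo eb]]]; exists (range e).
  exact: sub_countable (card_image_le _ _) (countableP _).
split; first by move=> _ [i _ <-].
move=> x A nA; have [i eix eiA] := eb x A nA.
by exists (e i) => //; split=> //; exists i.
Qed.

Lemma countable_basis_open_image (T U : topologicalType) (f : T -> U) :
  continuous f -> open_fun f -> (forall y, exists x, f x = y) ->
  countable_basis T -> countable_basis U.
Proof.
move=> cf fo fs [I [e [eo eb]]]; exists I, (fun i => f @` e i).
split=> [i|y A nA]; first exact: fo.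
have [x xE] := fs y; subst y; have [i eix eiA] := eb x _ (cf _ _ nA).
by exists i; [exists x | move=> _ [z /eiA ? <-]].
Qed.

Lemma countable_basis_sub (T : topologicalType) (A : set T) :
  countable_basis T -> countable_basis A.
Proof.
move=> [I [e [eo eb]]]; exists I, (fun i => val @^-1` e i).
split=> [i|x B [_ [[C oC <-] Cx CB]]]; first by exists (e i).
have [i eix eiC] := eb _ _ (open_nbhs_nbhs (conj oC Cx)).
by exists i => // z ez; apply/CB/eiC.
Qed.

Lemma countable_basis_prod (T U : topologicalType) :
  countable_basis T -> countable_basis U -> countable_basis (T * U)%type.
Proof.
move=> [I [e [eo eb]]] [J [d [dO db]]].
exists (I * J)%type, (fun k => e k.1 `*` d k.2); split=> [[i j] | [x y] A].
  rewrite openE => -[x y] [/= ex dy]; rewrite /interior.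
  exists (e i, d j) => //=.
  by split; apply: open_nbhs_nbhs.
move=> [[B C] [/= nB nC] BCA].
have [i eix eiB] := eb _ _ nB; have [j djy djC] := db _ _ nC.
exists (i, j) => // -[z t] [/= /eiB Bz /djC Ct]; exact: BCA.
Qed.

Lemma countable_basis_mx (T : topologicalType) m n :
  countable_basis T -> countable_basis 'M[T]_(m, n).
Proof.
move=> [I [e [eo eb]]].
exists 'M[I]_(m, n), (fun k : 'M[I]_(m, n) =>
  [set M : 'M[T]_(m, n) | forall i j, e (k i j) (M i j)]).
split=> [k|M A [B nB BA]].
  rewrite openE => M Mk; exists (fun i j => e (k i j)) => //= i j.
  by apply: open_nbhs_nbhs; split; [exact: eo | exact: Mk].
have /choice[f fP] (ij : 'I_m * 'I_n) :
    exists k, e k (M ij.1 ij.2) /\ e k `<=` B ij.1 ij.2.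
  by have [k] := eb _ _ (nB ij.1 ij.2); exists k.
exists (\matrix_(i, j) f (i, j)) => [i j|N Nf].
  by rewrite mxE; case: (fP (i, j)).
apply: BA => i j; have [_] := fP (i, j); apply.
by have := Nf i j; rewrite mxE.
Qed.

Lemma countable_basisR (R : realType) : countable_basis R.
Proof.
exists (rat * rat)%type, (fun k => `]ratr k.1, ratr k.2[%classic).
split=> [k|x A]; first exact: itv_open.
rewrite -nbhs_ballE => -[_ /posnumP[e]] eA.
have xe : x - e%:num < x by rewrite ltrBlDr ltrDl.
have ex : x < x + e%:num by rewrite ltrDl.
have [p] := rat_in_itvoo xe; have [q] := rat_in_itvoo ex.
rewrite !in_itv /= => /andP[xq qe] /andP[ep px]; exists (p, q) => /=.
  by rewrite in_itv /= px xq.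
move=> y; rewrite /= in_itv /= => /andP[py yq]; apply: eA.
rewrite /ball /= distrC ltr_distl (lt_trans ep py) /=.
exact: lt_trans yq qe.
Qed.

Lemma mx_continuous (T U : topologicalType) m n (f : T -> 'M[U]_(m, n)) x :
  (forall i j, {for x, continuous (fun t => f t i j)}) -> {for x, continuous f}.
Proof.
move=> cf A [B nB BA].
have : \forall t \near x, forall k : 'I_m * 'I_n, B k.1 k.2 (f t k.1 k.2).
  by apply: filter_forall => -[i j]; exact: cf (nB i j).
by apply: filterS => t tP; apply: BA => i j; exact: (tP (i, j)).
Qed.

Lemma eq_continuous_at (T U : topologicalType) (f g : T -> U) (x : T) :
  f =1 g -> {for x, continuous f} -> {for x, continuous g}.
Proof. by move=> /funext->. Qed.

Lemma near_eq_continuous_at (T U : topologicalType) (f g : T -> U) (x : T) :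
  (\forall t \near x, f t = g t) -> {for x, continuous f} -> {for x, continuous g}.
Proof.
move=> fg cf A; rewrite -(nbhs_singleton fg) => /cf; apply: filterS2 fg => t.
by rewrite /= => ->.
Qed.

Lemma near_neq0 (K : numFieldType) (T : topologicalType) (f : T -> K) x :
  {for x, continuous f} -> f x != 0 -> \forall t \near x, f t != 0.
Proof. by move=> cf fx; exact: (@cvgr_neq0 K K T (nbhs x) _ f (f x)). Qed.

End Topology.

(** * Connectedness by segments *)

Section Connected.
Variable R : realType.

Definition joined (T : topologicalType) (x y : T) :=
  connected_component [set: T] x y.

Lemma joined_trans (T : topologicalType) (y x z : T) :
  joined x y -> joined y z -> joined x z.
Proof. exact: connected_component_trans. Qed.

Lemma joined_sym (T : topologicalType) (x y : T) : joined x y -> joined y x.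
Proof. exact: connected_component_sym. Qed.

Lemma connected_joined (T : topologicalType) (x y : T) (A : set T) :
  connected A -> A x -> A y -> joined x y.
Proof. by move=> cA Ax Ay; rewrite /joined; exists A. Qed.

Lemma connectedT_joined (T : topologicalType) (x0 : T) :
  (forall x, joined x0 x) -> connected [set: T].
Proof.
move=> x0P; rewrite (_ : [set: T] = connected_component [set: T] x0).
  exact: component_connected.
by apply/seteqP; split=> x _ //; exact: x0P.
Qed.

Lemma joined_image (T U : topologicalType) (f : T -> U) x y :
  continuous f -> joined x y -> joined (f x) (f y).
Proof.
move=> cf [A [Ax _ cA] Ay]; exists (f @` A); last by exists y.
split; [by exists x | by [] |].
apply: connected_continuous_connected => //; exact: continuous_subspaceT.
Qed.

Lemma joined_pair (T U : topologicalType) (x x' : T) (y y' : U) :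
  joined x x' -> joined y y' -> joined (x, y) (x', y').
Proof.
move=> xx' yy'; apply: (@joined_trans _ (x', y)).
  apply: (@joined_image _ _ (fun z => (z, y))) xx' => z.
  by apply: cvg_pair; [exact: cvg_id | exact: cvg_cst].
apply: (@joined_image _ _ (fun z => (x', z))) yy' => z.
by apply: cvg_pair; [exact: cvg_cst | exact: cvg_id].
Qed.

(** The field [K] receives the real line through [io], so that one statement
    serves real and complex spaces; clamping the parameter to the unit
    interval makes the segment a map on the whole real line. *)
Lemma joined_segment (K : numFieldType) (io : R -> K) (V : normedModType K)
  (A : set V) (x y : A) :
  continuous io -> io 0 = 0 -> io 1 = 1 ->
  (forall t, 0 <= t <= 1 -> A (val x + io t *: (val y - val x))) ->
  joined x y.
Proof.
move=> cio io0 io1 seg.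
pose c (t : R) : R := Num.max 0 (Num.min 1 t).
have c01 t : 0 <= c t <= 1.
  by rewrite /c le_max lexx /= ge_max ler01 /= ge_min lexx.
have cc : continuous c.
  move=> t; apply: (@continuous_max R R (cst 0) (cst 1 \min id)).
    exact: cst_continuous.
  by apply: continuous_min; [exact: cst_continuous | exact: cvg_id].
pose g (t : R) : A := SigSub (mem_set (seg _ (c01 t))).
have gE t : val (g t) = val x + io (c t) *: (val y - val x) by [].
have -> : x = g 0.
  by apply: val_inj; rewrite gE /c minEle ler10 maxxx io0 scale0r addr0.
have -> : y = g 1.
  by apply: val_inj; rewrite gE /c minxx maxEle ler01 io1 scale1r addrC subrK.
have cg : continuous g.
  apply: continuous_comp_initial => t.
  apply: (@cvgD _ _ _ _ _ (fun=> val x)); first exact: cvg_cst.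
  apply: cvgZr_tmp; apply: (@continuous_comp _ _ _ c io); [exact: cc|exact: cio].
apply: (joined_image cg).
apply: (@connected_joined R 0 1 `[0, 1]%classic).
- exact: segment_connected.
- by rewrite /= in_itv /= lexx ler01.
- by rewrite /= in_itv /= lexx ler01.
Qed.

Lemma joinedT_segment (K : numFieldType) (io : R -> K) (V : normedModType K)
  (x y : V) : continuous io -> io 0 = 0 -> io 1 = 1 -> joined x y.
Proof.
move=> cio io0 io1.
pose f (x : V) : [set: V] := SigSub (mem_set (I : [set: V] x)).
apply: (@joined_image [set: V] _ val (f x) (f y)).
  exact: initial_continuous.
exact: (@joined_segment K io).
Qed.

End Connected.

(** * Power series of quotients of polynomials *)

Section Analytic.
Variables (R : realType) (n : nat).
Local Notation idx := {ffun 'I_n -> nat}.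

Definition monom (k : idx) (h : 'rV[R]_n) : R := \prod_(i < n) h 0 i ^+ k i.
Definition mdegree (k : idx) : nat := (\sum_(i < n) k i)%N.

Lemma monomD k l h : monom (k + l) h = monom k h * monom l h.
Proof. by rewrite /monom -big_split; apply: eq_bigr => i _; rewrite ffunE exprD. Qed.

Lemma monom0 h : monom 0 h = 1.
Proof. by rewrite /monom big1// => i _; rewrite ffunE. Qed.

Lemma monom_sum (I : Type) (s : seq I) (k : I -> idx) h :
  monom (\sum_(i <- s) k i) h = \prod_(i <- s) monom (k i) h.
Proof.
by elim/big_ind2: _ => [|k1 x1 k2 x2 <- <-|//]; [rewrite monom0|rewrite monomD].
Qed.

Lemma mdegreeD k l : mdegree (k + l) = (mdegree k + mdegree l)%N.
Proof. by rewrite /mdegree -big_split; apply: eq_bigr => i _; rewrite ffunE. Qed.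

Lemma mdegree_sum (I : Type) (s : seq I) (k : I -> idx) :
  mdegree (\sum_(i <- s) k i) = (\sum_(i <- s) mdegree (k i))%N.
Proof.
elim/big_ind2: _ => [|k1 x1 k2 x2 <- <-|//]; last exact: mdegreeD.
by rewrite /mdegree big1// => i _; rewrite ffunE.
Qed.

Lemma mdegree_gt0 (k : idx) : k != 0 -> (0 < mdegree k)%N.
Proof.
move=> kN0; rewrite lt0n; apply: contra kN0; rewrite sum_nat_eq0 => /forallP k0.
by apply/eqP/ffunP => i; rewrite ffunE; apply/eqP/k0.
Qed.

Lemma monom_at0 (k : idx) : k != 0 -> monom k 0 = 0.
Proof.
move=> k0; have : (0 < mdegree k)%N := mdegree_gt0 k0.
rewrite lt0n sum_nat_eq0 negb_forall => /existsP[i /= ki].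
by rewrite /monom (bigD1 i) //= mxE expr0n (negbTE ki) mul0r.
Qed.

Lemma monom_le k (h : 'rV[R]_n) (r : R) :
  (forall i, `|h 0 i| <= r) -> r <= 1 -> k != 0 ->
  `|monom k h| <= r.
Proof.
move=> hr r1 k0; have : (0 < mdegree k)%N := mdegree_gt0 k0.
rewrite lt0n sum_nat_eq0 negb_forall => /existsP[i /= ki].
rewrite /monom normr_prod (bigD1 i) //= -[r]mulr1 ler_pM //.
- by rewrite prodr_ge0.
- rewrite normrX -(prednK (n := k i)) ?lt0n// exprS -[r]mulr1 ler_pM ?exprn_ge0//.
  by rewrite exprn_ile1 // (le_trans (hr i)).
- apply: prodr_ile1 => j _.
  by rewrite normr_ge0 normrX exprn_ile1// (le_trans (hr j)).
Qed.

(** The terms of word length [l] may be regrouped by exponent because only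
    lengths up to [mdegree k] contribute to the exponent [k], so each
    coefficient is a finite sum; the geometric bound on the length makes the
    regrouped family converge unconditionally. *)
Lemma regroup_series (W : nat -> finType) (E : forall l, W l -> idx)
  (C : forall l, W l -> R) (h : 'rV[R]_n) (f M : R) :
  (forall l w, (l <= mdegree (@E l w))%N) ->
  (forall l, \sum_(w : W l) `|C l w * monom (E l w) h| <= M / 2 ^+ l) ->
  (forall L, `|f - \sum_(l < L) \sum_(w : W l) C l w * monom (E l w) h|
             <= M / 2 ^+ L) ->
  summability.partial_sum
    (fun k => (\sum_(l < (mdegree k).+1) \sum_(w : W l | E l w == k) C l w)
              * monom k h)
    @ summability.totally --> f.
Proof.
move=> degE bnd lim.
pose u l (w : W l) := C l w * monom (E l w) h.
pose a k := (\sum_(l < (mdegree k).+1) \sum_(w : W l | E l w == k) C l w)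
              * monom k h.
(* Lengths above the degree of [k] contribute nothing to the exponent [k]. *)
have aE k D : (mdegree k < D)%N ->
    a k = \sum_(l < D) \sum_(w : W l | E l w == k) u l w.
  move=> kD; rewrite /a -(big_mkord xpredT
    (fun l => \sum_(w : W l | E l w == k) C l w)).
  rewrite -(big_mkord xpredT (fun l => \sum_(w : W l | E l w == k) u l w)).
  rewrite [RHS](big_cat_nat (n := (mdegree k).+1)) //= [X in _ = _ + X]big_nat_cond.
  rewrite [X in _ = _ + X]big1 => [|l /andP[/andP[kl _] _]].
    rewrite addr0 mulr_suml; apply: eq_bigr => l _; rewrite mulr_suml.
    by apply: eq_bigr => w /eqP Ew; rewrite /u Ew.
  rewrite big1 // => w /eqP Ew.
  by have := degE l w; rewrite Ew leqNgt kl.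
have M0 : 0 <= M.
  have := lim 0%N; rewrite expr0 divr1; exact: le_trans.
have tail L D : (L <= D)%N -> \sum_(L <= l < D) M / 2 ^+ l <= 2 * M / 2 ^+ L.
  move=> LD; suff -> : \sum_(L <= l < D) M / 2 ^+ l = 2 * M / 2 ^+ L - 2 * M / 2 ^+ D.
    by rewrite gerBl divr_ge0 ?mulr_ge0 ?exprn_ge0.
  elim: D LD => [|D IH]; first by rewrite leqn0 => /eqP->; rewrite big_geq// subrr.
  rewrite leq_eqVlt => /predU1P[<-|LD]; first by rewrite big_geq// subrr.
  rewrite big_nat_recr //= IH // exprS; field.
  by rewrite !expf_neq0.

rewrite -/a; have FF := @summability.totally_filter idx.
suff: forall e, 0 < e -> \forall J \near summability.totally,
    `|f - summability.partial_sum a J| <= e by move/cvgrPdist_le.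
move=> e e0.
have [L Le] : exists L, 3 * M / 2 ^+ L <= e.
  have M3 : 0 <= 3 * M / e by rewrite divr_ge0 ?mulr_ge0 // ltW.
  exists (Num.Def.archi_bound (3 * M / e)).
  rewrite ler_pdivrMr ?exprn_gt0 // [leRHS]mulrC -ler_pdivrMr //.
  apply: le_trans (ltW (archi_boundP M3)) _.
  by rewrite -natrX ler_nat ltnW // ltn_expl.
(* The exponents of all words of length below [L]: a finite set that contains
   it leaves only terms of the tail. *)
pose J0 : {fset idx} := [fset k in
  flatten [seq [seq E l w | w <- enum (W l)] | l <- iota 0 L]]%fset.
exists J0 => //= J J0J.
rewrite /summability.partial_sum -(big_seq_fsetE _ _ xpredT a) /=.
pose D := maxn L (\max_(k <- J) mdegree k).+1.
have LD : (L <= D)%N by rewrite leq_maxl.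
have -> : \sum_(k <- J) a k =
    \sum_(l < D) \sum_(w : W l | E l w \in J) u l w.
  rewrite (eq_big_seq (fun k => \sum_(l < D) \sum_(w : W l | E l w == k) u l w)).
    rewrite exchange_big; apply: eq_bigr => l _ /=.
    rewrite [RHS]big_mkcond (eq_bigr _ (fun k _ => big_mkcond _ _)) exchange_big.
    apply: eq_bigr => w _ /=; case: ifPn => wJ.
      rewrite (bigD1_seq (E l w)) ?fset_uniq // eqxx big1 => [|k kE].
        exact: addr0.
      by rewrite eq_sym (negbTE kE).
    by rewrite big1_seq // => k /andP[_ kJ]; case: eqP => // Ek; rewrite Ek kJ in wJ.
  move=> k kJ; rewrite (aE k D) // leq_max; apply/orP; right.
  by rewrite ltnS; apply: (@leq_bigmax_seq _ _ xpredT mdegree k).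
rewrite -(big_mkord xpredT (fun l => \sum_(w : W l | E l w \in J) u l w)).
rewrite (big_cat_nat (n := L)) //=.
rewrite [X in _ - (X + _)](_ : _ = \sum_(l < L) \sum_w u l w).
  rewrite opprD addrA (le_trans (ler_normB _ _)) //; apply: le_trans Le.
  rewrite (_ : 3 * M / _ = M / 2 ^+ L + 2 * M / 2 ^+ L); last first.
    by field; rewrite !expf_neq0.
  apply: lerD; first exact: lim.
  apply: le_trans (tail _ _ LD); apply: le_trans (ler_norm_sum _ _ _) _.
  apply: ler_sum => l _; apply: le_trans (bnd l).
  apply: le_trans (ler_norm_sum _ _ _) _; rewrite big_mkcond ler_sum // => w _.
  by case: ifP.
rewrite big_mkord; apply: eq_bigr => l _; apply: eq_bigl => w.
have EJ0 : E l w \in J0.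
  rewrite inE /=; apply/flattenP; exists [seq E l w | w <- enum (W l)].
    by apply/mapP; exists (l : nat) => //; rewrite mem_iota /=.
  by rewrite map_f ?mem_enum.
by apply: (fsubsetP J0J).
Qed.

(** Polynomial functions, as finite combinations of monomials centred at any
    point [a]; the expansion at every centre is what the power series at [a]
    of a quotient starts from. *)
Definition polyfun (f : 'rV[R]_n -> R) :=
  forall a, exists s : seq (R * idx),
    forall x, f x = \sum_(m <- s) m.1 * monom m.2 (x - a).

Lemma polyfun_cst c : polyfun (fun=> c).
Proof. by move=> a; exists [:: (c, 0)] => x; rewrite big_seq1 monom0 mulr1. Qed.

Lemma polyfun_coord i : polyfun (fun x => x 0 i).
Proof.
move=> a; exists [:: (1, [ffun j => (j == i) : nat]); (a 0 i, 0)] => x.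
rewrite big_cons big_seq1 /= monom0 mulr1 mul1r /monom (bigD1 i) //= ffunE eqxx.
rewrite big1 => [|j ji]; last by rewrite ffunE (negbTE ji).
by rewrite mulr1 !mxE subrK.
Qed.

Lemma polyfunD f g : polyfun f -> polyfun g -> polyfun (fun x => f x + g x).
Proof.
move=> pf pg a; have [s sE] := pf a; have [t tE] := pg a.
by exists (s ++ t) => x; rewrite big_cat sE tE.
Qed.

Lemma polyfunM f g : polyfun f -> polyfun g -> polyfun (fun x => f x * g x).
Proof.
move=> pf pg a; have [s sE] := pf a; have [t tE] := pg a.
exists [seq (m.1 * p.1, m.2 + p.2) | m <- s, p <- t] => x.
rewrite big_allpairs_dep /= sE tE mulr_suml; apply: eq_bigr => m _.
by rewrite mulr_sumr; apply: eq_bigr => p _; rewrite monomD mulrACA.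
Qed.

Lemma prod_sum_words (I : finType) (F : I -> R) l :
  (\sum_i F i) ^+ l = \sum_(w : {ffun 'I_l -> I}) \prod_(j < l) F (w j).
Proof.
rewrite -(bigA_distr_bigA (fun _ : 'I_l => F)) /= big_const_ord.
by elim: l => [|l IH] //=; rewrite exprS IH.
Qed.

(** The quotient is [(p / q a) / (1 - g)] with [g] a polynomial without constant
    term in [x - a]; expanding the geometric series by words in the monomials
    of [g] gives terms of degree at least their length, and near [a] the sum of
    the absolute values of those of length [l] is at most a constant times
    [2^-l]. *)
Lemma polyfun_div_analytic p q a :
  polyfun p -> polyfun q -> q a != 0 -> real_analytic_at (fun x => p x / q x) a.
Proof.
move=> pp pq qa0; have [s sE] := pp a; have [t tE] := pq a.
(* [t0] lists the monomials of [g], which solves [q = q a * (1 - g)]. *)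
pose t0 := [seq (- m.1 / q a, m.2) | m <- t & m.2 != 0].
pose J := 'I_(size t0); pose I := 'I_(size s).
pose dg (j : J) : R := (nth (0, 0) t0 j).1.
pose eg (j : J) : idx := (nth (0, 0) t0 j).2.
pose df (i : I) : R := (nth (0, 0) s i).1 / q a.
pose ef (i : I) : idx := (nth (0, 0) s i).2.
pose g h := \sum_(j : J) dg j * monom (eg j) h.
have eg0 j : eg j != 0.
  have : nth (0, 0) t0 j \in t0 by rewrite mem_nth.
  by move=> /mapP[m]; rewrite mem_filter => /andP[m0 _]; rewrite /eg => ->.
have qaE : q a = \sum_(m <- t | m.2 == 0) m.1.
  rewrite tE subrr (bigID (fun m => m.2 == 0)) /= [X in _ + X]big1 ?addr0.
    by apply: eq_bigr => m /eqP->; rewrite monom0 mulr1.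
  by move=> m m0; rewrite monom_at0 // mulr0.
have qE x : q x = q a * (1 - g (x - a)).
  rewrite mulrBr mulr1 {1}qaE {1}tE (bigID (fun m => m.2 == 0)) /=; congr (_ + _).
    by apply: eq_bigr => m /eqP->; rewrite monom0 mulr1.
  rewrite /g /dg /eg -(big_mkord xpredT (fun j => (nth (0, 0) t0 j).1 *
    monom (nth (0, 0) t0 j).2 (x - a))).
  rewrite -(big_nth (0, 0) xpredT (fun m => m.1 * monom m.2 (x - a))).
  rewrite big_map big_filter mulr_sumr -sumrN /=; apply: eq_bigr => m _.
  by field.
have pE x : p x = q a * \sum_(i : I) df i * monom (ef i) (x - a).
  rewrite sE (big_nth (0, 0)) big_mkord mulr_sumr; apply: eq_bigr => i _.
  by rewrite /df; field.
pose S := \sum_(j : J) `|dg j|.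
have S0 : 0 <= S by rewrite sumr_ge0.
(* As [r <= 1] and no monomial of [g] is constant, each of them is at most [r]
   on the ball of radius [r], and [S * r <= 1 / 2]. *)
pose r : R := (2 * (1 + S))^-1.
have r0 : 0 < r by rewrite invr_gt0 mulr_gt0 // ltr_wpDr.
have r1 : r <= 1 by rewrite invf_le1 ?mulr_gt0 ?ltr_wpDr //; nra.
(* A term of length [l]: one monomial of [p / q a], then [l] monomials of [g]. *)
pose W l := (I * {ffun 'I_l -> J})%type : finType.
pose E l (w : W l) : idx := ef w.1 + \sum_(j < l) eg (w.2 j).
pose C l (w : W l) : R := df w.1 * \prod_(j < l) dg (w.2 j).
exists (fun k => \sum_(l < (mdegree k).+1) \sum_(w : W l | E l w == k) C l w), r.
split=> // x [_ axr].
pose h := x - a.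
have hr i : `|h 0 i| <= r.
  by have := axr 0 i; rewrite /ball /= distrC !mxE => /ltW.
have -> : (fun k : idx => (\sum_(l < (mdegree k).+1)
      \sum_(w : W l | E l w == k) C l w) * \prod_(i < n) (x 0 i - a 0 i) ^+ k i)
    = (fun k => (\sum_(l < (mdegree k).+1)
      \sum_(w : W l | E l w == k) C l w) * monom k h).
  by apply/funext => k; congr (_ * _); apply: eq_bigr => i _; rewrite !mxE.
have termE l (w : W l) : C l w * monom (E l w) h =
    (df w.1 * monom (ef w.1) h) * \prod_(j < l) (dg (w.2 j) * monom (eg (w.2 j)) h).
  by rewrite monomD monom_sum mulrACA big_split.
have sumE (F : I -> R) (G : J -> R) l :
    \sum_(w : W l) F w.1 * \prod_(j < l) G (w.2 j) = (\sum_i F i) * (\sum_j G j) ^+ l.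
  by rewrite prod_sum_words big_distrlr pair_bigA.
have gle : \sum_(j : J) `|dg j * monom (eg j) h| <= 1 / 2.
  apply: (@le_trans _ _ (S * r)).
    rewrite mulr_suml; apply: ler_sum => j _; rewrite normrM ler_wpM2l //.
    exact: monom_le.
  by rewrite /r ler_pdivrMr ?mulr_gt0 ?ltr_wpDr //; lra.
have g12 : `|g h| <= 1 / 2 by apply: le_trans (ler_norm_sum _ _ _) gle.
have g1 : 1 - g h != 0.
  rewrite subr_eq0; apply: contraTneq g12 => <-.
  by rewrite normr1 -ltNge; lra.
pose f0 := \sum_(i : I) df i * monom (ef i) h.
have fE : p x / q x = f0 / (1 - g h).
  by rewrite pE (qE x) -mulf_div divff // mul1r.
pose M1 := \sum_(i : I) `|df i * monom (ef i) h|; pose M := M1 + `|f0 / (1 - g h)|.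
have M10 : 0 <= M1 by rewrite sumr_ge0.
apply: (@regroup_series W E C h _ M).
- move=> l w; rewrite mdegreeD mdegree_sum; apply: leq_trans (leq_addl _ _).
  rewrite -[X in (X <= _)%N](card_ord l) -sum1_card leq_sum // => j _.
  exact: mdegree_gt0.
- move=> l; rewrite (eq_bigr (fun w : W l => `|df w.1 * monom (ef w.1) h| *
    \prod_(j < l) `|dg (w.2 j) * monom (eg (w.2 j)) h|)); last first.
    by move=> w _; rewrite termE normrM normr_prod.
  have /= -> := sumE (fun i => `|df i * monom (ef i) h|)
    (fun j => `|dg j * monom (eg j) h|) l.
  apply: ler_pM; rewrite ?exprn_ge0 ?sumr_ge0 //; first by rewrite lerDl.
  rewrite -exprVn -[2^-1]mul1r; apply: lerXn2r; rewrite ?nnegrE ?sumr_ge0 //; lra.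
- move=> L; rewrite fE (eq_bigr (fun l : 'I_L => f0 * g h ^+ l)); last first.
    move=> l _; have /= <- := sumE (fun i => df i * monom (ef i) h)
      (fun j => dg j * monom (eg j) h) l.
    by apply: eq_bigr => w _; exact: termE.
  rewrite -mulr_sumr (_ : _ - _ = f0 / (1 - g h) * g h ^+ L); last first.
    have := subrX1 (g h) L; set X := \sum_(i < L) _ => XE.
    have -> : X = (1 - g h ^+ L) / (1 - g h).
      by apply: (mulIf g1); rewrite divfK //; lra.
    by field.
  rewrite normrM ler_pM //; first by rewrite lerDr.
  rewrite normrX -exprVn -[2^-1]mul1r; apply: lerXn2r; rewrite ?nnegrE //; lra.
Qed.

End Analytic.

(** * The plane topology of the complex numbers *)

Section ComplexTopology.
Variable R : realType.
Local Notation C := (Cplx R).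

Definition reC (z : C) : R := complex.Re z.
Definition imC (z : C) : R := complex.Im z.
Definition toC (x : R) : C := Complex x 0.

Lemma conjCE (z : C) : Num.conj z = Complex (reC z) (- imC z).
Proof. by case: z. Qed.

Lemma reCD z t : reC (z + t) = reC z + reC t. Proof. by case: z; case: t. Qed.
Lemma imCD z t : imC (z + t) = imC z + imC t. Proof. by case: z; case: t. Qed.
Lemma reCB z t : reC (z - t) = reC z - reC t. Proof. by case: z; case: t. Qed.
Lemma imCB z t : imC (z - t) = imC z - imC t. Proof. by case: z; case: t. Qed.
Lemma reCM z t : reC (z * t) = reC z * reC t - imC z * imC t.
Proof. by case: z; case: t. Qed.
Lemma imCM z t : imC (z * t) = reC z * imC t + imC z * reC t.
Proof. by case: z; case: t. Qed.

Lemma complexP (z t : C) : reC z = reC t -> imC z = imC t -> z = t.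
Proof. by case: z => a b; case: t => c d /= -> ->. Qed.

Lemma toC_gt0 e : (0 < toC e) = (0 < e).
Proof. by rewrite ltcE /= eqxx. Qed.

(** The order of the complex numbers only compares numbers with the same
    imaginary part, so the radius of a complex ball is a real number. *)
Lemma Cgt0P (e : C) : 0 < e -> exists2 r : R, 0 < r & e = toC r.
Proof. by case: e => a b; rewrite ltcE /= => /andP[/eqP-> a0]; exists a. Qed.

Lemma normC_re (z : C) (r : R) : `|z| < toC r -> `|reC z| < r.
Proof.
rewrite normc_def ltcR; apply: le_lt_trans.
by rewrite -sqrtr_sqr ler_wsqrtr // lerDl sqr_ge0.
Qed.

Lemma normC_im (z : C) (r : R) : `|z| < toC r -> `|imC z| < r.
Proof.
rewrite normc_def ltcR; apply: le_lt_trans.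
by rewrite -sqrtr_sqr ler_wsqrtr // lerDr sqr_ge0.
Qed.

Lemma normC_lt (z : C) (r : R) :
  `|reC z| < r / 2 -> `|imC z| < r / 2 -> `|z| < toC r.
Proof.
move=> zr zi; have r0 : 0 < r by have := normr_ge0 (reC z); lra.
rewrite normc_def ltcR -[ltRHS]gtr0_norm // -sqrtr_sqr ltr_sqrt ?exprn_gt0 //.
have sq (a : R) : `|a| < r / 2 -> a ^+ 2 < (r / 2) ^+ 2.
  by move=> ar; rewrite -real_normK ?num_real // ltrXn2r // nnegrE; lra.
by have := sq _ zr; have := sq _ zi; rewrite -!/(reC _) -!/(imC _); nra.
Qed.

Lemma nbhsC_ballP (z : C) (A : set C) :
  nbhs z A <-> exists2 r : R, 0 < r & [set t | `|z - t| < toC r] `<=` A.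
Proof.
rewrite -nbhs_ballE; split=> [[e /= e0 eA]|[r r0 rA]].
  by have [r r0 eE] := Cgt0P e0; exists r => // t zt; apply: eA; rewrite eE.
by exists (toC r); [rewrite /= toC_gt0 | exact: rA].
Qed.

Lemma reC_continuous : continuous reC.
Proof.
move=> z; apply/(@cvgrPdist_lt _ _ _ _ (nbhs_filter z)) => e e0.
apply/nbhsC_ballP; exists e => // t zt.
by rewrite -reCB; exact: normC_re.
Qed.

Lemma imC_continuous : continuous imC.
Proof.
move=> z; apply/(@cvgrPdist_lt _ _ _ _ (nbhs_filter z)) => e e0.
apply/nbhsC_ballP; exists e => // t zt.
by rewrite -imCB; exact: normC_im.
Qed.

Lemma nbhsC_coord (z : C) (A : set C) : nbhs z A ->
  exists2 r : R, 0 < r &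
    forall t, `|reC z - reC t| < r -> `|imC z - imC t| < r -> A t.
Proof.
move=> /nbhsC_ballP[r r0 rA]; exists (r / 2); first by rewrite divr_gt0.
by move=> t rt it; apply: rA; apply: normC_lt; rewrite ?reCB ?imCB.
Qed.

Lemma continuousC (T : topologicalType) (f : T -> C) x :
  {for x, continuous (reC \o f)} -> {for x, continuous (imC \o f)} ->
  {for x, continuous f}.
Proof.
move=> cr ci A /nbhsC_coord[r r0 rA].
move: cr => /cvgrPdist_lt/(_ r r0); move: ci => /cvgrPdist_lt/(_ r r0).
apply: filterS2 => t ti tr; exact: rA.
Qed.

Lemma toC_continuous : continuous toC.
Proof.
by move=> x; apply: continuousC; [exact: cvg_id | exact: cvg_cst].
Qed.

Lemma conjC_continuous : continuous (Num.conj : C -> C).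
Proof.
move=> z; apply: continuousC.
  rewrite (_ : _ \o _ = reC); first exact: reC_continuous.
  by apply/funext => t /=; rewrite conjCE.
rewrite (_ : _ \o _ = (fun t => - imC t)).
  exact: (continuousN (imC_continuous (x := z))).
by apply/funext => t /=; rewrite conjCE.
Qed.

Lemma countable_basisC : countable_basis C.
Proof.
have [I [e [eo eb]]] := countable_basisR R.
exists (I * I)%type, (fun k => [set z : C | e k.1 (reC z) /\ e k.2 (imC z)]).
split=> [[i j]|z A /nbhsC_coord[r r0 rA]].
  apply: openI.
    by apply: (open_comp _ (eo i)) => z _; exact: reC_continuous.
  by apply: (open_comp _ (eo j)) => z _; exact: imC_continuous.
have [i eiz eir] := eb _ _ (nbhsx_ballx (reC z) r r0).
have [j ejz ejr] := eb _ _ (nbhsx_ballx (imC z) r r0).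
by exists (i, j) => //= t [/eir tr /ejr ti]; exact: rA.
Qed.

End ComplexTopology.

(** * Matrix expressions over a ring of functions *)

(** Continuity, differentiability and polynomiality of matrix expressions are
    all inherited from the entries by the same argument, which only uses
    closure under constants, sums and products. *)
Section FunctionRing.
Variables (K : comNzRingType) (T : Type) (P : (T -> K) -> Prop).

Definition fun_ring := [/\ forall c, P (fun=> c),
  forall f g, P f -> P g -> P (fun t => f t + g t)
  & forall f g, P f -> P g -> P (fun t => f t * g t)].

Definition mxfun m n (A : T -> 'M[K]_(m, n)) := forall i j, P (fun t => A t i j).

Hypothesis PR : fun_ring.

Lemma mxfun_cst m n (A : 'M[K]_(m, n)) : mxfun (fun=> A).
Proof. by case: PR => Pc _ _ i j. Qed.

Lemma fun_ring_sum (I : Type) (s : seq I) (f : I -> T -> K) :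
  (forall i, P (f i)) -> P (fun t => \sum_(i <- s) f i t).
Proof.
case: PR => Pc PD _ Pf; elim: s => [|i s IH].
  by rewrite (_ : (fun _ => _) = fun=> 0) //; apply/funext => t; rewrite big_nil.
rewrite (_ : (fun _ => _) = fun t => f i t + \sum_(j <- s) f j t); first exact: PD.
by apply/funext => t; rewrite big_cons.
Qed.

Lemma fun_ring_prod (I : Type) (s : seq I) (f : I -> T -> K) :
  (forall i, P (f i)) -> P (fun t => \prod_(i <- s) f i t).
Proof.
case: PR => Pc _ PM Pf; elim: s => [|i s IH].
  by rewrite (_ : (fun _ => _) = fun=> 1) //; apply/funext => t; rewrite big_nil.
rewrite (_ : (fun _ => _) = fun t => f i t * \prod_(j <- s) f j t); first exact: PM.
by apply/funext => t; rewrite big_cons.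
Qed.

Lemma mxfun_mul m n p (A : T -> 'M[K]_(m, n)) (B : T -> 'M[K]_(n, p)) :
  mxfun A -> mxfun B -> mxfun (fun t => A t *m B t).
Proof.
case: (PR) => _ _ PM PA PB i j.
rewrite (_ : (fun _ => _) = fun t => \sum_k A t i k * B t k j).
  by apply: fun_ring_sum => k; exact: PM.
by apply/funext => t; rewrite mxE.
Qed.

Lemma mxfun_det n (A : T -> 'M[K]_n) : mxfun A -> P (fun t => \det (A t)).
Proof.
case: (PR) => Pc _ PM PA; apply: fun_ring_sum => s; apply: PM; first exact: Pc.
by apply: fun_ring_prod => i; exact: PA.
Qed.

Lemma mxfun_adj n (A : T -> 'M[K]_n) : mxfun A -> mxfun (fun t => \adj (A t)).
Proof.
case: (PR) => Pc _ PM PA i j.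
rewrite (_ : (fun _ => _) = fun t => (-1) ^+ (j + i) * \det (row' j (col' i (A t)))).
  apply: PM; first exact: Pc.
  apply: mxfun_det => k l.
  rewrite (_ : (fun _ => _) = fun t => A t (lift j k) (lift i l)).
    exact: PA.
  by apply/funext => t; rewrite !mxE.
by apply/funext => t; rewrite mxE.
Qed.

End FunctionRing.

Lemma fun_ring_continuous (K : numFieldType) (T : topologicalType) (x : T) :
  fun_ring (fun f : T -> K => {for x, continuous f}).
Proof.
split=> [c|f g cf cg|f g cf cg]; first exact: cst_continuous.
  exact: continuousD.
exact: continuousM.
Qed.

Lemma fun_ring_differentiable (K : numFieldType) (V : normedModType K) (x : V) :
  fun_ring (fun f : V -> K => differentiable f x).
Proof.
split=> [c|f g df dg|f g df dg]; first exact: differentiable_cst.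
  exact: differentiableD.
exact: differentiableM.
Qed.

Section ComplexPolynomials.
Variables (R : realType) (n : nat).

Definition cpolyfun (f : 'rV[R]_n -> Cplx R) :=
  polyfun (fun x => reC (f x)) /\ polyfun (fun x => imC (f x)).

Lemma fun_ring_cpolyfun : fun_ring cpolyfun.
Proof.
have ext (f g : 'rV[R]_n -> R) : f =1 g -> polyfun f -> polyfun g.
  by move=> /funext->.
have polyN (f : 'rV[R]_n -> R) : polyfun f -> polyfun (fun x => - f x).
  move=> pf; apply: (ext _ _ _ (polyfunM (polyfun_cst (-1)) pf)) => x.
  by rewrite mulN1r.
split=> [c|f g [fr fi] [gr gi]|f g [fr fi] [gr gi]].
- by split; exact: polyfun_cst.
- split; first by apply: (ext _ _ _ (polyfunD fr gr)) => x; rewrite reCD.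
  by apply: (ext _ _ _ (polyfunD fi gi)) => x; rewrite imCD.
- split.
    apply: (ext _ _ _ (polyfunD (polyfunM fr gr)
      (polyN _ (polyfunM fi gi)))) => x.
    by rewrite reCM.
  by apply: (ext _ _ _ (polyfunD (polyfunM fr gi) (polyfunM fi gr))) => x; rewrite imCM.
Qed.

(** Multiplying by the conjugate of the denominator makes the denominator the
    real polynomial [|q|^2], so that real and imaginary parts are quotients of
    real polynomials. *)
Lemma cpolyfun_div_analytic (p q : 'rV[R]_n -> Cplx R) a :
  cpolyfun p -> cpolyfun q -> q a != 0 ->
  real_analytic_at (fun x => reC (p x / q x)) a /\
  real_analytic_at (fun x => imC (p x / q x)) a.
Proof.
move=> [pr pi] [qr qi] qa0.
pose N x := reC (q x) * reC (q x) + imC (q x) * imC (q x).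
have pN : polyfun N by apply: polyfunD; apply: polyfunM.
have Na0 : N a != 0.
  apply: contra qa0; rewrite /N -!expr2 paddr_eq0 ?sqr_ge0 // !sqrf_eq0.
  by move=> /andP[/eqP ra /eqP ia]; apply/eqP/complexP.
have polyB (f g : 'rV[R]_n -> R) :
    polyfun f -> polyfun g -> polyfun (fun x => f x - g x).
  move=> pf pg; have := polyfunD pf (polyfunM (polyfun_cst (-1)) pg).
  rewrite (_ : (fun _ => _) = fun x => f x - g x) //.
  by apply/funext => x; rewrite mulN1r.
have invE x : (q x)^-1 = Complex (reC (q x) / N x) (- (imC (q x) / N x)).
  rewrite /N -!expr2; case: (q x) => a' b' /=; rewrite /GRing.inv /=.
  by congr Complex.
split.
  rewrite (_ : (fun _ => _) = fun x =>
    (reC (p x) * reC (q x) + imC (p x) * imC (q x)) / N x).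
    by apply: polyfun_div_analytic => //; apply: polyfunD; apply: polyfunM.
  by apply/funext => x; rewrite reCM invE /=; ring.
rewrite (_ : (fun _ => _) = fun x =>
  (imC (p x) * reC (q x) - reC (p x) * imC (q x)) / N x).
  by apply: polyfun_div_analytic => //; apply: polyB; apply: polyfunM.
by apply/funext => x; rewrite imCM invE /=; ring.
Qed.

End ComplexPolynomials.

(** * The topology of the space of boundary conditions *)

Section BoundaryConditions.
Variable R : realType.
Local Notation C := (Cplx R).
Local Notation M24 := 'M[C]_(2, 2 + 2).

Definition pair_cols (i j : 'I_(2 + 2)) m (X : 'M[C]_(m, 2 + 2)) :
    'M[C]_(m, 2) :=
  colsub (fun k : 'I_2 => if k == 0 then i else j) X.

Lemma pair_colsM i j m n (T : 'M[C]_(m, n)) X :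
  pair_cols i j (T *m X) = T *m pair_cols i j X.
Proof. by apply/matrixP => a b; rewrite !mxE; apply: eq_bigr => k _; rewrite mxE. Qed.

Lemma pair_cols_rank2 i j (X : M24) : pair_cols i j X \in unitmx -> rank2 R X.
Proof.
rewrite -row_full_unit -col_leq_rank => rk; rewrite /rank2 /=.
apply/eqP; rewrite eqn_leq rank_leq_row /= (leq_trans rk) //.
rewrite (_ : pair_cols i j X = X *m pair_cols i j 1%:M) ?mxrankM_maxl //.
by rewrite -pair_colsM mulmx1.
Qed.

(** Full column rank of the transpose selects two independent columns. *)
Lemma rank2_pair_cols X : rank2 R X ->
  exists i j : 'I_(2 + 2), i != j /\ pair_cols i j X \in unitmx.
Proof.
move=> rkX; have fX : row_full X^T by rewrite -col_leq_rank mxrank_tr rkX.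
have finj := @fullrankfun_inj _ _ _ _ fX; have := fullrowsub_unit fX.
set f := fullrankfun fX in finj *; move=> fu; exists (f 0), (f 1).
split; first by apply/eqP => /finj.
rewrite -unitmx_tr (_ : _^T = rowsub f X^T) //; apply/matrixP => a b.
rewrite !mxE; congr (X _ _); case: eqP => [->//|]; case: a => -[|[|//]] ai a0.
  by case: a0; apply: val_inj.
by congr (f _); apply: val_inj.
Qed.

Lemma GL2_action_rank2 (T : 'M[C]_2) (X : rank2 R) : T \in unitmx ->
  rank2 R (T *m val X).
Proof.
move=> Tu; rewrite /rank2 /= (eqmxMfull _ _) ?row_full_unit //.
exact: (set_valP X).
Qed.

Lemma bc_classP (X Y : rank2 R) :
  bc_class X = bc_class Y <-> exists2 T, T \in unitmx & val Y = T *m val X.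
Proof.
split=> [/eqmodP|XY]; first by move=> /asboolP.
by apply/eqmodP; apply/asboolP.
Qed.

Lemma bc_class_surj (p : ABC R) : exists X, bc_class X = p.
Proof. by exists (repr p); rewrite /bc_class reprK. Qed.

Lemma represents_class (X : rank2 R) : represents (bc_class X) (val X).
Proof. by exists X. Qed.

Lemma representsP (p : ABC R) X Y : represents p X ->
  represents p Y <-> exists2 T, T \in unitmx & Y = T *m X.
Proof.
move=> [X' <- <-]; split.
  move=> [Y' <- /esym/bc_classP[T Tu YE]]; by exists T.
move=> [T Tu ->]; exists (SigSub (mem_set (GL2_action_rank2 X' Tu))) => //.
by apply/esym/bc_classP; exists T.
Qed.

Lemma bc_class_continuous : continuous (@bc_class R).
Proof. exact: pi_continuous. Qed.

Lemma rank2_coord_continuous a b : continuous (fun X : rank2 R => val X a b).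
Proof.
move=> X; apply: (@continuous_comp (rank2 R) M24 C val (fun M : M24 => M a b) X).
  exact: initial_continuous.
exact: coord_continuous.
Qed.

(** The projection is open: the saturation of an open set is the union of its
    translates by the homeomorphisms [X |-> T X]. *)
Lemma bc_class_open : open_fun (@bc_class R).
Proof.
move=> A oA; rewrite /open /= /quotient_open openE => Y [X AX /esym/bc_classP[T Tu XE]].
pose g (Z : rank2 R) : rank2 R := SigSub (mem_set (GL2_action_rank2 Z Tu)).
have cg : continuous g.
  apply: continuous_comp_initial => Z; apply: mx_continuous => i j.
  have FR := @fun_ring_continuous C _ Z.
  apply: (@mxfun_mul _ _ _ FR _ _ _ (fun=> T) (fun Z : rank2 R => val Z)).
    exact: mxfun_cst.
  by move=> a b; exact: rank2_coord_continuous.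
have gY : g Y = X by exact: val_inj.
have : nbhs Y (g @^-1` A) by apply: cg; apply: open_nbhs_nbhs; rewrite gY.
apply: filterS => Z AgZ; exists (g Z) => //.
by apply/esym/bc_classP; exists T.
Qed.

(** Two matrices of rank 2 are equivalent if and only if
    [det (X_ij) Y = Y_ij adj(X_ij) X] for all pairs of columns [ij], where
    [X_ij] is the submatrix of these columns: these equations are closed. *)
Lemma ABC_hausdorff : hausdorff_space (ABC R).
Proof.
apply: (hausdorff_open_quotient bc_class_open bc_class_surj).
pose F i j (q : rank2 R * rank2 R) : M24 :=
  \det (pair_cols i j (val q.1)) *: val q.2 +
  (-1) *: (pair_cols i j (val q.2) *m \adj (pair_cols i j (val q.1)) *m val q.1).
have FE (q : rank2 R * rank2 R) : bc_class q.1 = bc_class q.2 ->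
    forall i j, F i j q = 0.
  move=> /bc_classP[T _ q2E] i j; rewrite /F q2E pair_colsM scaleN1r.
  by rewrite -(mulmxA T) mul_mx_adj mul_mx_scalar -scalemxAl subrr.
rewrite openE => q /= q12.
have [i [j [ij Su]]] := rank2_pair_cols (set_valP q.1).
have : F i j q <> 0.
  move=> Fq; apply: q12; apply/bc_classP.
  pose T := pair_cols i j (val q.2) *m invmx (pair_cols i j (val q.1)).
  have q2E : val q.2 = T *m val q.1.
    rewrite /T /invmx Su; move/eqP: Fq; rewrite /F scaleN1r subr_eq0 => /eqP Fq.
    rewrite -scalemxAr -scalemxAl -Fq scalerA mulVr ?scale1r //.
  exists T => //; rewrite -row_full_unit -col_leq_rank.
  by rewrite -[leqLHS](set_valP q.2) {1}q2E mxrankM_maxl.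
move=> /eqP/matrix0Pn[r [c Frc]].
have cF : {for q, continuous (fun q => F i j q r c)}.
  have FR := @fun_ring_continuous C _ q; have [Pc PD PM] := FR.
  have v1 a b : {for q, continuous (fun q : rank2 R * rank2 R => val q.1 a b)}.
    apply: (@continuous_comp _ _ _ fst (fun X : rank2 R => val X a b)).
      exact: cvg_fst.
    exact: rank2_coord_continuous.
  have v2 a b : {for q, continuous (fun q : rank2 R * rank2 R => val q.2 a b)}.
    apply: (@continuous_comp _ _ _ snd (fun X : rank2 R => val X a b)).
      exact: cvg_snd.
    exact: rank2_coord_continuous.
  have s1 : mxfun (fun f : rank2 R * rank2 R -> C => {for q, continuous f})
      (fun q : rank2 R * rank2 R => pair_cols i j (val q.1)).
    by move=> a b; apply: eq_continuous_at (v1 a _) => t; rewrite mxE.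
  have s2 : mxfun (fun f : rank2 R * rank2 R -> C => {for q, continuous f})
      (fun q : rank2 R * rank2 R => pair_cols i j (val q.2)).
    by move=> a b; apply: eq_continuous_at (v2 a _) => t; rewrite mxE.
  pose d (q : rank2 R * rank2 R) := \det (pair_cols i j (val q.1)).
  pose G (q : rank2 R * rank2 R) :=
    pair_cols i j (val q.2) *m \adj (pair_cols i j (val q.1)) *m val q.1.
  have cd : {for q, continuous d} by exact: (mxfun_det FR s1).
  have cG : {for q, continuous (fun q => G q r c)}.
    have w1 : mxfun (fun f : rank2 R * rank2 R -> C => {for q, continuous f})
      (fun q : rank2 R * rank2 R => val q.1) by exact: v1.
    have a1 := mxfun_adj FR s1.
    have m1 := mxfun_mul FR s2 a1.
    have m2 := mxfun_mul FR m1 w1.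
    exact: m2 r c.
  have linE (a b : C) (A B : M24) : (a *: A + b *: B) r c = a * A r c + b * B r c.
    by rewrite !mxE.
  apply: eq_continuous_at (PD _ _ (PM _ _ cd (v2 r c)) (PM _ _ (Pc (-1)) cG)) => t.
  by rewrite /F linE.
have : nbhs q [set t | F i j t r c != 0].
  exact: near_neq0 cF Frc.
apply: filterS => t Ft /= /FE/(_ i j) F0.
by move: Ft; rewrite /= F0 mxE eqxx.
Qed.

Lemma ABC_countable_basis : countable_basis (ABC R).
Proof.
apply: (countable_basis_open_image bc_class_continuous bc_class_open bc_class_surj).
exact/countable_basis_sub/countable_basis_mx/countable_basisC.
Qed.

End BoundaryConditions.

(** * The six charts of the space of boundary conditions *)

Section Frames.
Variable R : realType.
Local Notation C := (Cplx R).
Local Notation M24 := 'M[C]_(2, 2 + 2).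
Local Notation I4 := 'I_(2 + 2).

Definition coords (k l : I4) (X : M24) : 'rV[C]_4 :=
  \row_a X (if (a < 2)%N then 0 else 1) (if odd a then l else k).

(** The six charts differ only in the columns that are fixed and in their value
    [nrm]; this records all that the study of a chart uses, so that it is made
    once. As the entries are constants or coordinates, [par] is continuous,
    holomorphic and polynomial for the same reason. *)
Record frame := Frame {
  par :> 'rV[C]_4 -> M24 ;
  col1 : I4 ; col2 : I4 ; col3 : I4 ; col4 : I4 ;
  nrm : 'M[C]_2 ;
  nrm_unit : nrm \in unitmx ;
  par_cols : forall v, pair_cols col1 col2 (par v) = nrm ;
  par_entry : forall r c, (exists a, forall v, par v r c = a) \/
                          (exists j, forall v, par v r c = v 0 j) ;
  parK : cancel par (coords col3 col4) ;
  coordsK : forall X, pair_cols col1 col2 X = nrm -> par (coords col3 col4 X) = X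
}.

Definition nrm2 (a b : C) : 'M[C]_2 := diag_mx (\row_j (if j == 0 then a else b)).

Lemma nrm2_unit a b : a != 0 -> b != 0 -> nrm2 a b \in unitmx.
Proof.
move=> a0 b0; rewrite unitmxE det_diag unitfE prodf_seq_neq0.
by apply/allP => j _; rewrite mxE; case: ifP.
Qed.

Local Notation o0 := (@Ordinal 4 0 isT : I4).
Local Notation o1 := (@Ordinal 4 1 isT : I4).
Local Notation o2 := (@Ordinal 4 2 isT : I4).
Local Notation o3 := (@Ordinal 4 3 isT : I4).

Ltac cols_tac := move=> v; apply/matrixP => -[[|[|//]] ri] [[|[|//]] ci];
  rewrite !mxE /= ?mxE /= ?mulr1n ?mulr0n; try done.
Ltac entry_tac := move=> [[|[|//]] ri] [[|[|[|[|//]]]] ci];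
  first [left; eexists => v; rewrite mxE /=; reflexivity
        |right; eexists => v; rewrite mxE /=; reflexivity].
Ltac parK_tac := move=> v; apply/rowP => -[[|[|[|[|//]]]] ci];
  rewrite !mxE /=; congr (fun_of_matrix _ _ _); apply: val_inj.
Ltac coordsK_tac := move=> X /matrixP XE; apply/matrixP
    => -[[|[|//]] ri] [[|[|[|[|//]]]] ci]; rewrite !mxE /= ?mxE;
  first [by congr (fun_of_matrix _ _ _); apply: val_inj |
  lazymatch goal with XE : _ =2 _ |- _ =>
  let entry i j := (let h := fresh in have h := XE i j;
    rewrite !mxE /= ?mxE /= ?mulr1n ?mulr0n in h; rewrite -[LHS]h;
    by congr (fun_of_matrix _ _ _); apply: val_inj) in
  first [entry (0 : 'I_2) (0 : 'I_2) | entry (0 : 'I_2) (1 : 'I_2)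
        |entry (1 : 'I_2) (0 : 'I_2) | entry (1 : 'I_2) (1 : 'I_2)] end].

Definition frame12 : frame.
Proof.
refine (@Frame (@N12 R) o0 o1 o2 o3 (nrm2 1 1) _ _ _ _ _).
- by apply: nrm2_unit; rewrite ?oppr_eq0 oner_eq0.
- by cols_tac.
- by entry_tac.
- by parK_tac.
- by coordsK_tac.
Defined.

Definition frame13 : frame.
Proof.
refine (@Frame (@N13 R) o0 o2 o1 o3 (nrm2 1 (-1)) _ _ _ _ _).
- by apply: nrm2_unit; rewrite ?oppr_eq0 oner_eq0.
- by cols_tac.
- by entry_tac.
- by parK_tac.
- by coordsK_tac.
Defined.

Definition frame14 : frame.
Proof.
refine (@Frame (@N14 R) o0 o3 o1 o2 (nrm2 1 1) _ _ _ _ _).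
- by apply: nrm2_unit; rewrite ?oppr_eq0 oner_eq0.
- by cols_tac.
- by entry_tac.
- by parK_tac.
- by coordsK_tac.
Defined.

Definition frame23 : frame.
Proof.
refine (@Frame (@N23 R) o1 o2 o0 o3 (nrm2 (-1) (-1)) _ _ _ _ _).
- by apply: nrm2_unit; rewrite ?oppr_eq0 oner_eq0.
- by cols_tac.
- by entry_tac.
- by parK_tac.
- by coordsK_tac.
Defined.

Definition frame24 : frame.
Proof.
refine (@Frame (@N24 R) o1 o3 o0 o2 (nrm2 (-1) 1) _ _ _ _ _).
- by apply: nrm2_unit; rewrite ?oppr_eq0 oner_eq0.
- by cols_tac.
- by entry_tac.
- by parK_tac.
- by coordsK_tac.
Defined.

Definition frame34 : frame.
Proof.
refine (@Frame (@N34 R) o2 o3 o0 o1 (nrm2 (-1) (-1)) _ _ _ _ _).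
- by apply: nrm2_unit; rewrite ?oppr_eq0 oner_eq0.
- by cols_tac.
- by entry_tac.
- by parK_tac.
- by coordsK_tac.
Defined.

End Frames.

Section FrameCharts.
Variable R : realType.
Local Notation C := (Cplx R).
Local Notation M24 := 'M[C]_(2, 2 + 2).
Implicit Types F : frame R.

Definition minor F (X : M24) : 'M[C]_2 := pair_cols (col1 F) (col2 F) X.

(** Numerator and denominator of the representative in the class of [X] whose
    columns [col1] and [col2] are in normal form. *)
Definition den F (X : M24) : C := \det (minor F X).
Definition num F (X : M24) : M24 := nrm F *m \adj (minor F X) *m X.
Definition normal_form F (X : M24) : M24 := (den F X)^-1 *: num F X.

Definition frame_coords F (X : M24) : 'rV[C]_4 :=
  coords (col3 F) (col4 F) (normal_form F X).

Lemma minor_den F X : (minor F X \in unitmx) = (den F X != 0).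
Proof. by rewrite unitmxE unitfE. Qed.

Lemma normal_formE F X : minor F X \in unitmx ->
  normal_form F X = nrm F *m invmx (minor F X) *m X.
Proof.
by move=> u; rewrite /normal_form /num /invmx u -scalemxAr -scalemxAl.
Qed.

Lemma normal_form_cols F X : minor F X \in unitmx ->
  pair_cols (col1 F) (col2 F) (normal_form F X) = nrm F.
Proof. by move=> u; rewrite normal_formE // pair_colsM mulmxKV. Qed.

Lemma par_frame_coords F X : minor F X \in unitmx ->
  par F (frame_coords F X) = normal_form F X.
Proof. by move=> /normal_form_cols; exact: coordsK. Qed.

Lemma represents_normal_form F p X : minor F X \in unitmx ->
  represents p X -> represents p (par F (frame_coords F X)).
Proof.
move=> u pX; apply/(representsP _ pX); exists (nrm F *m invmx (minor F X)).
  by rewrite unitmx_mul nrm_unit unitmx_inv.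
by rewrite par_frame_coords // normal_formE.
Qed.

Lemma minor_par F v : minor F (par F v) \in unitmx.
Proof. by rewrite /minor par_cols nrm_unit. Qed.

Lemma frame_coords_par F p X v : represents p X -> represents p (par F v) ->
  minor F X \in unitmx /\ frame_coords F X = v.
Proof.
move=> pX /(representsP _ pX)[T Tu vE].
have nE : T *m minor F X = nrm F by rewrite /minor -pair_colsM -vE par_cols.
have mu : minor F X \in unitmx.
  by have := nrm_unit F; rewrite -nE unitmx_mul => /andP[].
split=> //; rewrite -[RHS](@parK _ F); congr coords.
by rewrite normal_formE // -nE mulmxK // vE.
Qed.

Lemma par_rank2 F v : rank2 R (par F v).
Proof. exact: pair_cols_rank2 (minor_par F v). Qed.

Definition frame_class F (v : 'rV[C]_4) : ABC R :=
  bc_class (SigSub (mem_set (par_rank2 F v))).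

Lemma represents_frame_class F v : represents (frame_class F v) (par F v).
Proof. by exists (SigSub (mem_set (par_rank2 F v))). Qed.

Definition frame_chart F : chart C (ABC R) := param_chart (@represents R) (par F).

Lemma frame_chart_domP F p X : represents p X ->
  cdom (frame_chart F) p <-> minor F X \in unitmx.
Proof.
move=> pX; split=> [[v] /(frame_coords_par pX)[]//|u].
by exists (frame_coords F X); exact: represents_normal_form.
Qed.

Lemma frame_chart_mapE F p X : represents p X -> minor F X \in unitmx ->
  cmap (frame_chart F) p = frame_coords F X.
Proof.
move=> pX u; apply/esym; have /(xgetPex 0) : exists v, represents p (par F v).
  by exists (frame_coords F X); exact: represents_normal_form.
by move=> /(frame_coords_par pX)[].
Qed.

Lemma frame_chart_class F v :
  cdom (frame_chart F) (frame_class F v) /\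
  cmap (frame_chart F) (frame_class F v) = v.
Proof.
have fv := represents_frame_class F v.
split; first by exists v.
rewrite (frame_chart_mapE fv) ?minor_par //.
by have [_] := frame_coords_par fv fv.
Qed.

Section Regularity.
Variables (T : Type) (P : (T -> C) -> Prop) (PR : fun_ring P).

Lemma mxfun_minor F (A : T -> M24) :
  mxfun P A -> mxfun P (fun t => minor F (A t)).
Proof.
move=> PA i j; rewrite (_ : (fun _ => _) =
  fun t => A t i (if j == 0 then col1 F else col2 F)); first exact: PA.
by apply/funext => t; rewrite mxE.
Qed.

Lemma fun_den F (A : T -> M24) : mxfun P A -> P (fun t => den F (A t)).
Proof. by move=> /(mxfun_minor F); exact: mxfun_det. Qed.

Lemma mxfun_num F (A : T -> M24) : mxfun P A -> mxfun P (fun t => num F (A t)).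
Proof.
move=> PA; have PS := mxfun_adj PR (mxfun_minor F PA).
by have := mxfun_mul PR (mxfun_mul PR (mxfun_cst PR (nrm F)) PS) PA.
Qed.

Lemma mxfun_par F (v : T -> 'rV[C]_4) :
  mxfun P v -> mxfun P (fun t => par F (v t)).
Proof.
move=> Pv r c; case: PR => Pc _ _; have [[a aE]|[j jE]] := par_entry F r c.
  by rewrite (_ : (fun _ => _) = fun=> a) //; apply/funext.
by rewrite (_ : (fun _ => _) = fun t => v t 0 j) //; apply/funext => t.
Qed.

End Regularity.

Lemma frame_coordsE F X j : frame_coords F X 0 j =
  num F X (if (j < 2)%N then 0 else 1) (if odd j then col4 F else col3 F)
    / den F X.
Proof. by rewrite mxE mxE mulrC. Qed.

Lemma frame_coords_continuous (T : topologicalType) F (A : T -> M24) (x : T) :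
  {for x, continuous A} -> minor F (A x) \in unitmx ->
  {for x, continuous (fun t => frame_coords F (A t))}.
Proof.
move=> cA; rewrite minor_den => d0; apply: mx_continuous => i j.
have PR := @fun_ring_continuous C T x.
have PA : mxfun (fun f : T -> C => {for x, continuous f}) A.
  by move=> r c; apply: (@continuous_comp T M24 C A (fun M : M24 => M r c) x);
    [exact: cA | exact: coord_continuous].
have cn := mxfun_num PR F PA; have cd := fun_den PR F PA.
have := continuousM (cn (if (j < 2)%N then 0 else 1)
  (if odd j then col4 F else col3 F)) (@continuousV _ _ (fun t => den F (A t)) x d0 cd).
by apply: eq_continuous_at => t; rewrite (ord1 i) frame_coordsE.
Qed.

Lemma frame_chart_continuous F p : cdom (frame_chart F) p ->
  {for p, continuous (cmap (frame_chart F))}.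
Proof.
have [X <-] := bc_class_surj p.
rewrite (frame_chart_domP F (represents_class X)) => u.
apply: (continuous_open_quotient (@bc_class_open R)).
have cv : {for X, continuous (val : rank2 R -> M24)} by exact: initial_continuous.
apply: near_eq_continuous_at (frame_coords_continuous cv u).
have cd : {for X, continuous (fun Y : rank2 R => den F (val Y))}.
  apply: (fun_den (@fun_ring_continuous C _ X)) => r c.
  exact: rank2_coord_continuous.
have d0 : den F (val X) != 0 by rewrite -minor_den.
apply: filterS (near_neq0 cd d0) => Y; rewrite -minor_den => uY.
exact/esym/(frame_chart_mapE (represents_class Y)).
Qed.

Lemma frame_chart_open F : open (cdom (frame_chart F)).
Proof.
rewrite /open /= /quotient_open openE => X.
move=> /(frame_chart_domP F (represents_class X)); rewrite minor_den => d0.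
have cd : {for X, continuous (fun Y : rank2 R => den F (val Y))}.
  apply: (fun_den (@fun_ring_continuous C _ X)) => r c.
  exact: rank2_coord_continuous.
apply: filterS (near_neq0 cd d0) => Y; rewrite -minor_den => uY.
exact/(frame_chart_domP F (represents_class Y)).
Qed.

Lemma frame_class_continuous F : continuous (frame_class F).
Proof.
move=> v; apply: (@continuous_comp _ (rank2 R) _ _ (@bc_class R)); last first.
  exact: bc_class_continuous.
apply: continuous_comp_initial => {}v; apply: mx_continuous => r c.
apply: (mxfun_par (@fun_ring_continuous C _ v)) => i j.
exact: coord_continuous.
Qed.

Lemma frame_chart_is_chart F : is_chart (frame_chart F).
Proof.
have imT : cmap (frame_chart F) @` cdom (frame_chart F) = setT.
  apply/seteqP; split=> // v _.
  by exists (frame_class F v); have [] := frame_chart_class F v.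
split; first exact: frame_chart_open.
- by rewrite imT; exact: openT.
- rewrite (continuous_open_subspace _ (frame_chart_open F)) => p /set_mem.
  exact: frame_chart_continuous.
- exists (frame_class F).
    by apply: continuous_subspaceT; exact: frame_class_continuous.
  move=> p; have [X <-] := bc_class_surj p.
  have pX := represents_class X.
  rewrite (frame_chart_domP F pX) => u; rewrite (frame_chart_mapE pX) //.
  have [Y YE <-] := represents_normal_form u pX.
  by congr bc_class; apply: val_inj.
Qed.

End FrameCharts.

Section AtlasABC.
Variable R : realType.
Local Notation C := (Cplx R).
Local Notation M24 := 'M[C]_(2, 2 + 2).

Definition frames : set (frame R) :=
  [set frame12 R; frame13 R; frame14 R; frame23 R; frame24 R; frame34 R].

Lemma ABC_atlasP c : ABC_atlas R c <-> exists2 F, frames F & c = frame_chart F.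
Proof.
split.
  move=> [P + <-] /= => -[[[[[]|]|]|]|] ->.
  - by exists (frame12 R) => //; do 5 left.
  - by exists (frame13 R) => //; do 4 left; right.
  - by exists (frame14 R) => //; do 3 left; right.
  - by exists (frame23 R) => //; do 2 left; right.
  - by exists (frame24 R) => //; left; right.
  - by exists (frame34 R) => //; right.
move=> [F + ->] /= => -[[[[[]|]|]|]|] ->.
- by exists (@N12 R) => //; do 5 left.
- by exists (@N13 R) => //; do 4 left; right.
- by exists (@N14 R) => //; do 3 left; right.
- by exists (@N23 R) => //; do 2 left; right.
- by exists (@N24 R) => //; left; right.
- by exists (@N34 R) => //; right.
Qed.

Lemma pair_cols_unit_sym (i j : 'I_(2 + 2)) (X : M24) :
  pair_cols i j X \in unitmx -> pair_cols j i X \in unitmx.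
Proof.
move=> u; rewrite (_ : pair_cols j i X = xcol 0 1 (pair_cols i j X)).
  by rewrite xcolE unitmx_mul u unitmx_perm.
apply/matrixP => r c; rewrite !mxE.
have [->|->] : c = 0 \/ c = 1.
  by case: c => -[|[|//]] h; [left|right]; apply: val_inj.
  by rewrite perm.tpermL.
by rewrite perm.tpermR.
Qed.

Lemma frames_cover (X : M24) : rank2 R X ->
  exists2 F, frames F & minor F X \in unitmx.
Proof.
move=> /rank2_pair_cols[i [j [ij]]].
wlog: i j ij / (i < j)%N => [H|].
  move: ij; rewrite neq_ltn => /orP[] lt u; apply: (H _ _ _ lt) => //.
  - by rewrite neq_ltn lt.
  - by rewrite neq_ltn lt.
  - exact: pair_cols_unit_sym.
have mE (F : frame R) : (i : nat) = col1 F -> (j : nat) = col2 F ->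
    minor F X = pair_cols i j X.
  by move=> /val_inj-> /val_inj->.
case: i j ij mE => [[|[|[|[|//]]]] hi] [[|[|[|[|//]]]] hj] ij mE // _ u.
- by exists (frame12 R); [do 5 left | rewrite mE].
- by exists (frame13 R); [do 4 left; right | rewrite mE].
- by exists (frame14 R); [do 3 left; right | rewrite mE].
- by exists (frame23 R); [do 2 left; right | rewrite mE].
- by exists (frame24 R); [left; right | rewrite mE].
- by exists (frame34 R); [right | rewrite mE].
Qed.

End AtlasABC.

(** * The four charts of the self-adjoint boundary conditions *)

Section SelfAdjoint.
Variable R : realType.
Local Notation C := (Cplx R).
Local Notation M24 := 'M[C]_(2, 2 + 2).
Implicit Types F : frame R.
Local Notation o0 := (@Ordinal 4 0 isT : 'I_(2 + 2)).
Local Notation o1 := (@Ordinal 4 1 isT : 'I_(2 + 2)).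
Local Notation o2 := (@Ordinal 4 2 isT : 'I_(2 + 2)).
Local Notation o3 := (@Ordinal 4 3 isT : 'I_(2 + 2)).

Lemma Emx_form (A : 'M[C]_2) r s : (A *m Emx R *m ctr A) r s =
  A r 0 * Num.conj (A s 1) - A r 1 * Num.conj (A s 0).
Proof.
rewrite mxE big_ord_recl big_ord1 /ctr !mxE !big_ord_recl !big_ord0 /= !mxE /=.
rewrite !mulr0 !mulr1 !mulrN1 !addr0 !add0r.
rewrite (_ : lift ord0 ord0 = 1); last exact: val_inj.
by rewrite mulNr addrC.
Qed.

Lemma self_adjointP (X : M24) : self_adjoint X <-> forall r s,
  X r o0 * Num.conj (X s o1) - X r o1 * Num.conj (X s o0) =
  X r o2 * Num.conj (X s o3) - X r o3 * Num.conj (X s o2).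
Proof.
have lE r : (lsubmx X r 0 = X r o0) * (lsubmx X r 1 = X r o1).
  by split; rewrite mxE; congr (X _ _); apply: val_inj.
have rE r : (rsubmx X r 0 = X r o2) * (rsubmx X r 1 = X r o3).
  by split; rewrite mxE; congr (X _ _); apply: val_inj.
split=> [/matrixP sa r s|sa].
  by have := sa r s; rewrite !Emx_form !lE !rE.
by apply/matrixP => r s; rewrite !Emx_form !lE !rE.
Qed.

Lemma self_adjointM (T : 'M[C]_2) (X : M24) :
  self_adjoint X -> self_adjoint (T *m X).
Proof.
rewrite /self_adjoint -mulmx_lsub -mulmx_rsub.
have formM (A : 'M[C]_2) : T *m A *m Emx R *m ctr (T *m A) =
    T *m (A *m Emx R *m ctr A) *m ctr T.
  by rewrite /ctr trmx_mul map_mxM !mulmxA.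
by move=> sa; rewrite !formM sa.
Qed.

Lemma self_adjoint_represents (p : BBC R) X :
  represents (val p) X -> self_adjoint X.
Proof.
move=> pX; have [Y pY saY] := set_valP p.
by have [T _ ->] := (representsP X pY).1 pX; exact: self_adjointM.
Qed.

(** The coordinates [(a, b, z)] of a self-adjoint condition sit in the complex
    coordinates of each of the four charts in the same places, as
    [(a, z^*, z, b)]. *)
Definition emb (v : 'rV[R]_4) : 'rV[C]_4 :=
  \row_j [:: toC (v 0 0); Num.conj (Complex (v 0 2) (v 0 3) : C);
             Complex (v 0 2) (v 0 3); toC (v 0 1)]`_j.
Definition proj (w : 'rV[C]_4) : 'rV[R]_4 :=
  \row_j [:: reC (w 0 0); reC (w 0 3); reC (w 0 2); imC (w 0 2)]`_j.

Lemma embK : cancel emb proj.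
Proof.
move=> v; apply/rowP => -[[|[|[|[|//]]]] h]; rewrite !mxE /=;
  by congr (v _ _); apply: val_inj.
Qed.

Definition sa_frames : set (frame R) :=
  [set frame13 R; frame14 R; frame23 R; frame24 R].

Lemma emb_projP (w : 'rV[C]_4) : w = emb (proj w) <->
  [/\ Num.conj (w 0 0) = w 0 0, w 0 1 = Num.conj (w 0 2)
    & Num.conj (w 0 3) = w 0 3].
Proof.
have conj_re (z : C) : Num.conj z = z <-> z = toC (reC z).
  rewrite conjCE; case: z => a b; split=> [[/= ib]|[/= ->]]; last by rewrite oppr0.
  by congr Complex; lra.
have reE (z : C) : Complex (reC z) (imC z) = z by case: z.
split=> [->|[/conj_re w0 w1 /conj_re w3]].
  by rewrite !mxE /=; split=> //; apply/conj_re.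
apply/rowP => j; rewrite mxE !mxE /= reE.
case: j => -[|[|[|[|//]]]] h /=.
- by rewrite -w0; congr (w _ _); apply: val_inj.
- by rewrite -w1; congr (w _ _); apply: val_inj.
- by congr (w _ _); apply: val_inj.
- by rewrite -w3; congr (w _ _); apply: val_inj.
Qed.

(** With the columns in normal form, [A E A^* = B E B^*] says that the two
    diagonal parameters are real and the two others conjugate. *)
Lemma sa_framesP F w : sa_frames F ->
  self_adjoint (par F w) <-> w = emb (proj w).
Proof.
have c0 : Num.conj (0 : C) = 0 by exact: rmorph0.
have c1 : Num.conj (1 : C) = 1 by exact: rmorph1.
have cN1 : Num.conj (-1 : C) = -1 by rewrite rmorphN1.
have cK (a : C) : Num.conj (Num.conj a) = a by exact: conjCK.
have s2 : forall r : 'I_2, r = 0 \/ r = 1.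
  by case=> -[|[|//]] h; [left|right]; apply: val_inj.
rewrite emb_projP => Fsa; split=> [/self_adjointP H|].
  have := H 1 1; have := H 0 1; have := H 0 0; clear H.
  case: Fsa => [[[]|]|] ->; rewrite !mxE /=;
    move: (w 0 0) (w 0 1) (w 0 2) (w 0 3) => a b c d; rewrite !(c0, c1, cN1,
  mul0r, mulr0, mul1r, mulr1, subr0, sub0r, mulrN1, mulN1r, oppr0, opprK);
    rewrite ?(addrC (- a)) ?(addrC (- Num.conj d));
    move=> /subr0_eq h0 h1 /esym/subr0_eq h3; split=> //; by rewrite -?h0 -?h1 -?h3.
move=> [w0 w1 w3]; apply/self_adjointP => r s.
case: Fsa => [[[]|]|] ->; case: (s2 r) => ->; case: (s2 s) => ->;
  rewrite !mxE /=; move: w0 w1 w3;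
  move: (w 0 0) (w 0 1) (w 0 2) (w 0 3) => a b c d a0 b0 d0;
  rewrite ?(c0, c1, cN1, b0, cK, a0, d0, mul0r, mulr0, mul1r, mulr1, subr0, sub0r,
    mulrN1, mulN1r, oppr0, opprK, subrr, addNr) //.
Qed.

End SelfAdjoint.

Section SelfAdjointCharts.
Variable R : realType.
Local Notation C := (Cplx R).
Local Notation M24 := 'M[C]_(2, 2 + 2).
Implicit Types F : frame R.
Local Notation o0 := (@Ordinal 4 0 isT : 'I_(2 + 2)).
Local Notation o1 := (@Ordinal 4 1 isT : 'I_(2 + 2)).
Local Notation o2 := (@Ordinal 4 2 isT : 'I_(2 + 2)).
Local Notation o3 := (@Ordinal 4 3 isT : 'I_(2 + 2)).

Lemma denE F X : den F X =
  X 0 (col1 F) * X 1 (col2 F) - X 0 (col2 F) * X 1 (col1 F).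
Proof.
rewrite /den (expand_det_row _ 0) !big_ord_recl big_ord0 /cofactor !det_mx11.
rewrite !mxE /= addr0 expr0 expr1 mul1r mulN1r mulrN.
by congr (X _ _ * X _ _ - X _ _ * X _ _); apply: val_inj.
Qed.

(** For a self-adjoint pair the equation [A E A^* = B E B^*] gives
    [|det A| = |det B|]; by the Pluecker relation, the four minors mixing one
    column of [A] and one of [B] cannot vanish together. *)
Lemma sa_frames_cover (X : M24) : rank2 R X -> self_adjoint X ->
  exists2 F, sa_frames F & minor F X \in unitmx.
Proof.
move=> rX sa; pose a := den (frame12 R) X; pose b := den (frame34 R) X.
have ab : a * Num.conj a = b * Num.conj b.
  have detform (A : 'M[C]_2) :
      \det (A *m Emx R *m ctr A) = \det A * Num.conj (\det A).
    have detE : \det (Emx R) = 1.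
      rewrite (expand_det_row _ 0) !big_ord_recl big_ord0 /cofactor !det_mx11.
      by rewrite !mxE /= !mul0r addr0 add0r expr1 mul1r mulN1r opprK.
    by rewrite !det_mulmx detE mulr1 /ctr det_map_mx det_tr.
  have aE : \det (lsubmx X) = a.
    rewrite /a /den; congr (\det _); apply/matrixP => r c; rewrite !mxE.
    by congr (X _ _); apply: val_inj; case: c => -[|[|//]].
  have bE : \det (rsubmx X) = b.
    rewrite /b /den; congr (\det _); apply/matrixP => r c; rewrite !mxE.
    by congr (X _ _); apply: val_inj; case: c => -[|[|//]].
  by rewrite -aE -bE -!detform sa.
have ab0 : (a == 0) = (b == 0).
  apply/idP/idP => /eqP z0; move: ab; rewrite z0 mul0r => /eqP.
    by rewrite eq_sym mulf_eq0 conjC_eq0 orbb.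
  by rewrite mulf_eq0 conjC_eq0 orbb.
have plu : a * b = den (frame13 R) X * den (frame24 R) X
                 - den (frame14 R) X * den (frame23 R) X.
  by rewrite /a /b !denE /=; ring.
have mixed : a != 0 -> exists2 F, sa_frames F & minor F X \in unitmx.
  move=> a0; have : a * b != 0 by rewrite mulf_eq0 -ab0 orbb.
  rewrite plu; have [->|d13 _] := eqVneq (den (frame13 R) X) 0; last first.
    by exists (frame13 R); [do 3 left | rewrite minor_den].
  have [->|d14 _] := eqVneq (den (frame14 R) X) 0; last first.
    by exists (frame14 R); [do 2 left; right | rewrite minor_den].
  by rewrite !mul0r subrr eqxx.
have [F [[[[[]|]|]|]|] -> u] := frames_cover rX.
- by apply: mixed; rewrite -minor_den.
- by exists (frame13 R); [do 3 left |].
- by exists (frame14 R); [do 2 left; right |].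
- by exists (frame23 R); [left; right |].
- by exists (frame24 R); [right |].
- by apply: mixed; rewrite ab0 -minor_den.
Qed.

Lemma BBC_rank2 (p : BBC R) : exists2 X : rank2 R,
  bc_class X = val p & exists2 F, sa_frames F & minor F (val X) \in unitmx.
Proof.
have [X Xp] := bc_class_surj (val p); exists X => //.
apply: sa_frames_cover; first exact: set_valP.
by apply: (@self_adjoint_represents _ p); exists X.
Qed.

Lemma frame_class_sa F v : sa_frames F -> BBC R (frame_class F (emb v)).
Proof.
move=> Fsa; exists (par F (emb v)); first exact: represents_frame_class.
by apply/(sa_framesP _ Fsa); rewrite embK.
Qed.

Definition sa_class F (Fsa : sa_frames F) (v : 'rV[R]_4) : BBC R :=
  SigSub (mem_set (frame_class_sa v Fsa)).

Definition sa_chart F : chart R (BBC R) :=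
  param_chart (fun p : BBC R => represents (val p)) (fun v => par F (emb v)).

Lemma sa_frame_coords F (Fsa : sa_frames F) (p : BBC R) X :
  represents (val p) X -> minor F X \in unitmx ->
  emb (proj (frame_coords F X)) = frame_coords F X.
Proof.
move=> pX u; apply/esym/(sa_framesP _ Fsa).
exact: self_adjoint_represents (represents_normal_form u pX).
Qed.

Lemma sa_chart_domP F (Fsa : sa_frames F) (p : BBC R) X :
  represents (val p) X -> cdom (sa_chart F) p <-> minor F X \in unitmx.
Proof.
move=> pX; split=> [[v] /(frame_coords_par pX)[]//|u].
exists (proj (frame_coords F X)); rewrite (sa_frame_coords Fsa pX u).
exact: represents_normal_form.
Qed.

Lemma sa_chart_mapE F (Fsa : sa_frames F) (p : BBC R) X :
  represents (val p) X -> minor F X \in unitmx ->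
  cmap (sa_chart F) p = proj (frame_coords F X).
Proof.
move=> pX u; have /(xgetPex 0) : exists v, represents (val p) (par F (emb v)).
  exists (proj (frame_coords F X)); rewrite (sa_frame_coords Fsa pX u).
  exact: represents_normal_form.
by move=> /(frame_coords_par pX)[_ ->]; rewrite embK.
Qed.

Lemma represents_sa_class F (Fsa : sa_frames F) v :
  represents (val (sa_class Fsa v)) (par F (emb v)).
Proof. exact: represents_frame_class. Qed.

Lemma sa_chart_class F (Fsa : sa_frames F) v :
  cdom (sa_chart F) (sa_class Fsa v) /\ cmap (sa_chart F) (sa_class Fsa v) = v.
Proof.
have fv := represents_sa_class Fsa v; split; first by exists v.
rewrite (sa_chart_mapE Fsa fv) ?minor_par //.
by have [_ ->] := frame_coords_par fv fv; rewrite embK.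
Qed.

Lemma sa_chartE F (Fsa : sa_frames F) (p : BBC R) : 
  (cdom (sa_chart F) p <-> cdom (frame_chart F) (val p)) /\
  (cdom (sa_chart F) p -> cmap (sa_chart F) p = proj (cmap (frame_chart F) (val p))).
Proof.
have [X Xp] := bc_class_surj (val p).
have pX : represents (val p) (val X) by exists X.
have dE := sa_chart_domP Fsa pX; have dE' := frame_chart_domP F pX.
split; first by rewrite dE dE'.
by move=> /dE u; rewrite (sa_chart_mapE Fsa pX u) (frame_chart_mapE pX u).
Qed.

Lemma sa_chart_open F : sa_frames F -> open (cdom (sa_chart F)).
Proof.
move=> Fsa; exists (cdom (frame_chart F)); first exact: frame_chart_open.
by apply/seteqP; split=> p /(sa_chartE Fsa p).1.
Qed.

Lemma emb_continuous : continuous (@emb R).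
Proof.
have zc : continuous (fun v : 'rV[R]_4 => Complex (v 0 2) (v 0 3) : C).
  by move=> v; apply: continuousC; exact: coord_continuous.
move=> v; apply: mx_continuous => i j.
pose f (k : nat) (v : 'rV[R]_4) : C := [:: toC (v 0 0);
  Num.conj (Complex (v 0 2) (v 0 3) : C); Complex (v 0 2) (v 0 3); toC (v 0 1)]`_k.
apply: (@eq_continuous_at _ _ (f j)) => [t|]; first by rewrite mxE.
case: j => -[|[|[|[|//]]]] h /=; rewrite /f /=.
- apply: (@continuous_comp _ R C (fun v : 'rV[R]_4 => v 0 0) (@toC R)).
    exact: coord_continuous.
  exact: toC_continuous.
- apply: (@continuous_comp _ C C _ (Num.conj : C -> C)); first exact: zc.
  exact: conjC_continuous.
- exact: zc.
- apply: (@continuous_comp _ R C (fun v : 'rV[R]_4 => v 0 1) (@toC R)).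
    exact: coord_continuous.
  exact: toC_continuous.
Qed.

Lemma proj_continuous : continuous (@proj R).
Proof.
move=> w; apply: mx_continuous => i j.
pose f (k : nat) (w : 'rV[C]_4) : R :=
  [:: reC (w 0 0); reC (w 0 3); reC (w 0 2); imC (w 0 2)]`_k.
apply: (@eq_continuous_at _ _ (f j)) => [t|]; first by rewrite mxE.
have rc k : {for w, continuous (fun w : 'rV[C]_4 => reC (w 0 k))}.
  apply: (@continuous_comp _ C R (fun w : 'rV[C]_4 => w 0 k) (@reC R)).
    exact: coord_continuous.
  exact: reC_continuous.
case: j => -[|[|[|[|//]]]] h /=; rewrite /f /=; try exact: rc.
apply: (@continuous_comp _ C R (fun w : 'rV[C]_4 => w 0 2) (@imC R)).
  exact: coord_continuous.
exact: imC_continuous.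
Qed.

Lemma sa_class_continuous F (Fsa : sa_frames F) : continuous (sa_class Fsa).
Proof.
apply: continuous_comp_initial => v.
apply: (@continuous_comp _ _ _ (@emb R) (frame_class F)); first exact: emb_continuous.
exact: frame_class_continuous.
Qed.

Lemma sa_chart_is_chart F : sa_frames F -> is_chart (sa_chart F).
Proof.
move=> Fsa.
have imT : cmap (sa_chart F) @` cdom (sa_chart F) = setT.
  apply/seteqP; split=> // v _.
  by exists (sa_class Fsa v); have [] := sa_chart_class Fsa v.
split; first exact: sa_chart_open.
- by rewrite imT; exact: openT.
- rewrite (continuous_open_subspace _ (sa_chart_open Fsa)) => p /set_mem dp.
  have cv : {for p, continuous (val : BBC R -> ABC R)} by exact: initial_continuous.
  have ct : {for p, continuous (fun p : BBC R => proj (cmap (frame_chart F) (val p)))}.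
    apply: (@continuous_comp _ _ _ _ (@proj R)); last exact: proj_continuous.
    have cf := frame_chart_continuous ((sa_chartE Fsa p).1.1 dp).
    exact: (@continuous_comp (BBC R) (ABC R) _ val _ p cv cf).
  apply: near_eq_continuous_at ct.
  have : nbhs p (cdom (sa_chart F)).
    by apply: open_nbhs_nbhs; split=> //; exact: sa_chart_open.
  by apply: filterS => t /(sa_chartE Fsa t).2.
- exists (sa_class Fsa).
    by apply: continuous_subspaceT; exact: sa_class_continuous.
  move=> p; have [X Xp] := bc_class_surj (val p).
  have pX : represents (val p) (val X) by exists X.
  move=> /(sa_chart_domP Fsa pX) u; rewrite (sa_chart_mapE Fsa pX u).
  apply: val_inj; rewrite /= (sa_frame_coords Fsa pX u).
  have [Y YE <-] := represents_normal_form u pX.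
  by congr bc_class; apply: val_inj.
Qed.

Lemma BBC_atlasP c : BBC_atlas R c <-> exists2 F, sa_frames F & c = sa_chart F.
Proof.
have E13 : @O13 R = fun v => par (frame13 R) (emb v).
  by apply/funext => v; apply/matrixP => r c0; rewrite !mxE /= ?mxE.
have E14 : @O14 R = fun v => par (frame14 R) (emb v).
  by apply/funext => v; apply/matrixP => r c0; rewrite !mxE /= ?mxE.
have E23 : @O23 R = fun v => par (frame23 R) (emb v).
  by apply/funext => v; apply/matrixP => r c0; rewrite !mxE /= ?mxE.
have E24 : @O24 R = fun v => par (frame24 R) (emb v).
  by apply/funext => v; apply/matrixP => r c0; rewrite !mxE /= ?mxE.
split.
  move=> [P + <-] /= => -[[[]|]|] ->.
  - by exists (frame13 R); [do 3 left | rewrite E13].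
  - by exists (frame14 R); [do 2 left; right | rewrite E14].
  - by exists (frame23 R); [left; right | rewrite E23].
  - by exists (frame24 R); [right | rewrite E24].
move=> [F + ->] /= => -[[[]|]|] ->.
- by exists (@O13 R); [do 3 left | rewrite E13].
- by exists (@O14 R); [do 2 left; right | rewrite E14].
- by exists (@O23 R); [left; right | rewrite E23].
- by exists (@O24 R); [right | rewrite E24].
Qed.

End SelfAdjointCharts.

(** * Products of charts *)

Section ProductManifold.
Variable K : numFieldType.

Lemma lsubmx_continuous m n1 n2 : continuous (@lsubmx K m n1 n2).
Proof.
move=> w; apply: mx_continuous => i j.
apply: (@eq_continuous_at _ _ (fun w : 'M[K]_(m, n1 + n2) => w i (lshift n2 j))).
  by move=> t; rewrite mxE.
exact: coord_continuous.
Qed.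

Lemma rsubmx_continuous m n1 n2 : continuous (@rsubmx K m n1 n2).
Proof.
move=> w; apply: mx_continuous => i j.
apply: (@eq_continuous_at _ _ (fun w : 'M[K]_(m, n1 + n2) => w i (rshift n1 j))).
  by move=> t; rewrite mxE.
exact: coord_continuous.
Qed.

Lemma row_mx_continuous (T : topologicalType) m n1 n2 (f : T -> 'M[K]_(m, n1))
  (g : T -> 'M[K]_(m, n2)) x : {for x, continuous f} -> {for x, continuous g} ->
  {for x, continuous (fun t => row_mx (f t) (g t))}.
Proof.
move=> cf cg; apply: mx_continuous => i j; case: (splitP j) => k jk.
  have -> : j = lshift n2 k by exact: val_inj.
  apply: (@eq_continuous_at _ _ (fun t => f t i k)).
    by move=> t; rewrite row_mxEl.
  apply: (@continuous_comp T 'M[K]_(m, n1) K f (fun M : 'M[K]_(m, n1) => M i k) x cf).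
  exact: coord_continuous.
have -> : j = rshift n1 k by exact: val_inj.
apply: (@eq_continuous_at _ _ (fun t => g t i k)).
  by move=> t; rewrite row_mxEr.
apply: (@continuous_comp T 'M[K]_(m, n2) K g (fun M : 'M[K]_(m, n2) => M i k) x cg).
exact: coord_continuous.
Qed.

Lemma open_setX (T U : topologicalType) (A : set T) (B : set U) :
  open A -> open B -> open (A `*` B).
Proof.
rewrite !openE => oA oB [x y] [/= Ax By]; exists (A, B) => //=.
by split; [exact: oA | exact: oB].
Qed.

Lemma prod_chart_is_chart (M1 M2 : topologicalType) (c1 : chart K M1)
  (c2 : chart K M2) : is_chart c1 -> is_chart c2 -> is_chart (prod_chart c1 c2).
Proof.
move=> [u1 i1 m1 [g1 cg1 g1K]] [u2 i2 m2 [g2 cg2 g2K]].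
have imE : cmap (prod_chart c1 c2) @` cdom (prod_chart c1 c2) =
    lsubmx @^-1` (cmap c1 @` cdom c1) `&` rsubmx @^-1` (cmap c2 @` cdom c2).
  apply/seteqP; split=> [_ [[x y] [/= dx dy] <-]|w [/= [x dx xE] [y dy yE]]].
    by split=> /=; rewrite ?row_mxKl ?row_mxKr; [exists x | exists y].
  by exists (x, y) => //=; rewrite xE yE hsubmxK.
have oim : open (cmap (prod_chart c1 c2) @` cdom (prod_chart c1 c2)).
  rewrite imE; apply: openI; apply: open_comp => // w _.
    exact: lsubmx_continuous.
  exact: rsubmx_continuous.
have od : open (cdom (prod_chart c1 c2)) by exact: open_setX.
split=> //.
- rewrite (continuous_open_subspace _ od) => -[x y] /set_mem [/= dx dy].
  rewrite (continuous_open_subspace _ u1) in m1.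
  rewrite (continuous_open_subspace _ u2) in m2.
  have f1 : {for (x, y), continuous (fun p : M1 * M2 => cmap c1 p.1)}.
    apply: (@continuous_comp _ _ _ fst (cmap c1)); first exact: cvg_fst.
    exact/m1/mem_set.
  have f2 : {for (x, y), continuous (fun p : M1 * M2 => cmap c2 p.2)}.
    apply: (@continuous_comp _ _ _ snd (cmap c2)); first exact: cvg_snd.
    exact/m2/mem_set.
  exact: row_mx_continuous f1 f2.
- exists (fun w => (g1 (lsubmx w), g2 (rsubmx w))); last first.
    by move=> [x y] [/= dx dy]; rewrite row_mxKl row_mxKr g1K // g2K.
  rewrite (continuous_open_subspace _ oim) => w /set_mem.
  rewrite imE => -[/= w1 w2].
  rewrite (continuous_open_subspace _ i1) in cg1.
  rewrite (continuous_open_subspace _ i2) in cg2.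
  have l1 : {for w, continuous (fun w : 'rV_(cdim c1 + cdim c2) => g1 (lsubmx w))}.
    apply: (@continuous_comp _ _ _ (@lsubmx K 1 _ _) g1).
      exact: lsubmx_continuous.
    exact/cg1/mem_set.
  have l2 : {for w, continuous (fun w : 'rV_(cdim c1 + cdim c2) => g2 (rsubmx w))}.
    apply: (@continuous_comp _ _ _ (@rsubmx K 1 _ _) g2).
      exact: rsubmx_continuous.
    exact/cg2/mem_set.
  exact: cvg_pair l1 l2.
Qed.

(** When the first factor has a single global chart, the changes of charts of
    the product are the identity on the first block. Smoothness is asked over
    every set [D] that projects into the overlap of two charts of the second
    factor, so that nothing depends on the image of the first chart. *)
Lemma prod_manifold (smooth : smoothness K) (M1 M2 : topologicalType)
  (c1 : chart K M1) (A2 : set (chart K M2)) (n2 : nat) :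
  hausdorff_space M1 -> hausdorff_space M2 ->
  countable_basis M1 -> countable_basis M2 ->
  is_chart c1 -> cdom c1 = setT ->
  (forall c, A2 c -> cdim c = n2 /\ is_chart c) ->
  (forall x, exists2 c, A2 c & cdom c x) ->
  (forall c c', A2 c -> A2 c' ->
    exists2 tau : 'rV[K]_(cdim c) -> 'rV[K]_(cdim c'),
      forall D : set 'rV[K]_(cdim c1 + cdim c),
        (forall w, D w -> (cmap c @` (cdom c `&` cdom c')) (rsubmx w)) ->
        smooth _ _ D (fun w => row_mx (lsubmx w) (tau (rsubmx w)))
    & forall x, cdom c x -> cdom c' x -> tau (cmap c x) = cmap c' x) ->
  is_manifold smooth (prod_atlas [set c1] A2) (cdim c1 + n2)%N.
Proof.
move=> h1 h2 b1 b2 ch1 d1 ch2 cov tr; split.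
- exact: hausdorff_prod.
- exact/countable_basisP/countable_basis_prod.
- move=> _ [_ -> [c2 A2c2 <-]]; have [cn cc] := ch2 _ A2c2.
  by split; [rewrite /= cn | exact: prod_chart_is_chart].
- move=> [x y]; have [c2 A2c2 c2y] := cov y.
  exists (prod_chart c1 c2); first by exists c1 => //; exists c2.
  by split; rewrite /= ?d1.
- move=> _ _ [_ -> [c A2c <-]] [_ -> [c' A2c' <-]].
  have [tau st tauE] := tr _ _ A2c A2c'.
  exists (fun w : 'rV_(cdim c1 + cdim c) => row_mx (lsubmx w) (tau (rsubmx w))).
    apply: st => _ [[x y] [[/= _ cy] [_ c'y]] <-].
    by rewrite row_mxKr; exists y.
  by move=> [x y] [/= _ cy] [_ c'y]; rewrite row_mxKl row_mxKr tauE.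
Qed.

End ProductManifold.

(** * The global chart of the coefficient space *)

Section OmegaChart.
Variables (K : numFieldType) (N : nat).

Definition split_row (w : 'rV[K]_(N.+1 + N + N)) : triple K N :=
  (lsubmx (lsubmx w), rsubmx (lsubmx w), rsubmx w).

Lemma split_row_continuous : continuous split_row.
Proof.
move=> w; have cl := @lsubmx_continuous K 1 (N.+1 + N) N w.
have c3 := @rsubmx_continuous K 1 (N.+1 + N) N w.
have c1 : {for w, continuous
    (fun w : 'rV[K]_(N.+1 + N + N) => lsubmx (lsubmx w) : 'rV_N.+1)}.
  apply: (@continuous_comp _ _ _ (@lsubmx K 1 _ _) (@lsubmx K 1 _ _) _ cl).
  exact: lsubmx_continuous.
have c2 : {for w, continuous
    (fun w : 'rV[K]_(N.+1 + N + N) => rsubmx (lsubmx w) : 'rV_N)}.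
  apply: (@continuous_comp _ _ _ (@lsubmx K 1 _ _) (@rsubmx K 1 _ _) _ cl).
  exact: rsubmx_continuous.
exact: cvg_pair (cvg_pair c1 c2) c3.
Qed.

Lemma Omega_chart_is_chart (Omega : set (triple K N)) :
  open Omega -> Omega !=set0 -> is_chart (Omega_chart Omega).
Proof.
move=> oO [p0 Op0].
have imE : cmap (Omega_chart Omega) @` cdom (Omega_chart Omega) =
    split_row @^-1` Omega.
  apply/seteqP; split=> [_ [p _ <-]|w Ow].
    rewrite /= /split_row !row_mxKl !row_mxKr -!surjective_pairing.
    exact: set_valP.
  by exists (SigSub (mem_set (Ow : Omega (split_row w)))) => //=; rewrite !hsubmxK.
have oim : open (cmap (Omega_chart Omega) @` cdom (Omega_chart Omega)).
  by rewrite imE; apply: open_comp oO => w _; exact: split_row_continuous.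
split=> //.
- exact: openT.
- apply: continuous_subspaceT => p.
  have cv : {for p, continuous (val : Omega -> triple K N)}.
    exact: initial_continuous.
  have c1 : {for p, continuous (fun p : Omega => (val p).1)}.
    apply: (@continuous_comp Omega (triple K N) ('rV[K]_N.+1 * 'rV[K]_N)%type
      val fst p cv); exact: cvg_fst.
  have c2 : {for p, continuous (fun p : Omega => (val p).2)}.
    apply: (@continuous_comp Omega (triple K N) 'rV[K]_N val snd p cv); exact: cvg_snd.
  have c11 : {for p, continuous (fun p : Omega => (val p).1.1)}.
    apply: (@continuous_comp Omega _ 'rV[K]_N.+1 (fun p : Omega => (val p).1) fst p c1).
    exact: cvg_fst.
  have c12 : {for p, continuous (fun p : Omega => (val p).1.2)}.
    apply: (@continuous_comp Omega _ 'rV[K]_N (fun p : Omega => (val p).1) snd p c1).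
    exact: cvg_snd.
  exact: row_mx_continuous (row_mx_continuous c11 c12) c2.
- pose g (w : 'rV_(N.+1 + N + N)) : Omega :=
    xget (SigSub (mem_set Op0)) [set p : Omega | val p = split_row w].
  have gE w : Omega (split_row w) -> val (g w) = split_row w.
    move=> Ow; have : exists p : Omega, val p = split_row w.
      by exists (SigSub (mem_set Ow)).
    by move=> /(xgetPex (SigSub (mem_set Op0))).
  exists g.
    rewrite (continuous_open_subspace _ oim) => w /set_mem.
    rewrite imE => Ow A [_ [[B oB <-] Bg BA]].
    have : nbhs w (split_row @^-1` (Omega `&` B)).
      apply: split_row_continuous; apply: open_nbhs_nbhs; split; first exact: openI.
      by split=> //; rewrite -gE.
    apply: filterS => t [Ot Bt]; apply: BA => /=.
    by rewrite set_valE /= gE.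
  move=> p _; apply: val_inj.
  rewrite gE /split_row !row_mxKl !row_mxKr -!surjective_pairing //.
  exact: set_valP.
Qed.

Lemma inv_rowP n (a : 'rV[K]_n) :
  (exists2 f : 'rV[K]_n, forall i, f 0 i != 0 & a = map_mx GRing.inv f) <->
  forall i, a 0 i != 0.
Proof.
split=> [[f f0 -> i]|a0]; first by rewrite mxE invr_eq0.
exists (map_mx GRing.inv a) => [i|]; first by rewrite mxE invr_eq0.
by apply/rowP => i; rewrite !mxE invrK.
Qed.

Lemma triple_coord1 i : continuous (fun p : triple K N => p.1.1 0 i).
Proof.
move=> p; apply: (@continuous_comp _ _ _ (fun p : triple K N => p.1.1)
  (fun a : 'rV[K]_N.+1 => a 0 i)); last exact: coord_continuous.
by apply: (@continuous_comp _ _ _ fst fst p); [exact: cvg_fst | exact: cvg_fst].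
Qed.

Lemma triple_coord3 i : continuous (fun p : triple K N => p.2 0 i).
Proof.
move=> p; apply: (@continuous_comp _ _ _ (fun p : triple K N => p.2)
  (fun a : 'rV[K]_N => a 0 i)); last exact: coord_continuous.
exact: cvg_snd.
Qed.

End OmegaChart.

(** * Changes of charts *)

Section Holomorphic.
Variable R : realType.
Local Notation C := (Cplx R).
Implicit Types F : frame R.

Lemma rV_differentiable (K : numFieldType) (V : normedModType K) n
  (f : V -> 'rV[K]_n) x :
  (forall j, differentiable (fun v => f v 0 j) x) -> differentiable f x.
Proof.
move=> df; rewrite (_ : f = \sum_j (fun v => f v 0 j *: (delta_mx 0 j : 'rV[K]_n))).
  by apply: differentiable_sum => j; exact: differentiableZl.
by apply/funext => v; rewrite fct_sumE [LHS]row_sum_delta.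
Qed.

Lemma frame_transition_minor F F' v :
  (cmap (frame_chart F) @` (cdom (frame_chart F) `&` cdom (frame_chart F'))) v ->
  minor F' (par F v) \in unitmx.
Proof.
move=> [p [dp dp'] <-]; have [X Xp] := bc_class_surj p.
have pX : represents p (val X) by exists X.
move/(frame_chart_domP F pX) : dp => u; rewrite (frame_chart_mapE pX u).
exact/(frame_chart_domP F' (represents_normal_form u pX)).
Qed.

Lemma frame_transition F F' p : cdom (frame_chart F) p -> cdom (frame_chart F') p ->
  frame_coords F' (par F (cmap (frame_chart F) p)) = cmap (frame_chart F') p.
Proof.
have [X Xp] := bc_class_surj p; have pX : represents p (val X) by exists X.
move=> /(frame_chart_domP F pX) u; rewrite (frame_chart_mapE pX u).
have pY := represents_normal_form u pX.
by move=> /(frame_chart_domP F' pY) u'; rewrite (frame_chart_mapE pY u').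
Qed.

Lemma holomorphic_transition n F F' (D : set 'rV[C]_(n + 4)) :
  (forall w, D w -> minor F' (par F (rsubmx w)) \in unitmx) ->
  holomorphic_on D (fun w : 'rV[C]_(n + 4) =>
    row_mx (lsubmx w) (frame_coords F' (par F (rsubmx w)))).
Proof.
move=> Du w Dw; apply: rV_differentiable => j; case: (splitP j) => k jk.
  have -> : j = lshift 4 k by exact: val_inj.
  rewrite (_ : (fun _ => _) = fun w : 'rV[C]_(n + 4) => w 0 (lshift 4 k)).
    exact: differentiable_coord.
  by apply/funext => v; rewrite row_mxEl mxE.
have -> : j = rshift n k by exact: val_inj.
have FR := @fun_ring_differentiable C 'rV[C]_(n + 4) w.
have PA : mxfun (fun f : 'rV[C]_(n + 4) -> C => differentiable f w)
    (fun w : 'rV[C]_(n + 4) => par F (rsubmx w)).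
  apply: (mxfun_par FR) => r c.
  rewrite (_ : (fun _ => _) = fun w : 'rV[C]_(n + 4) => w r (rshift n c)).
    exact: differentiable_coord.
  by apply/funext => v; rewrite mxE.
have cn := mxfun_num FR F' PA (if (k < 2)%N then 0 else 1)
  (if odd k then col4 F' else col3 F').
have cd := fun_den FR F' PA.
rewrite (_ : (fun _ => _) = fun w : 'rV[C]_(n + 4) =>
  num F' (par F (rsubmx w)) (if (k < 2)%N then 0 else 1)
    (if odd k then col4 F' else col3 F') * (den F' (par F (rsubmx w)))^-1).
  apply: differentiableM => //; apply: differentiableV => //.
  by rewrite -minor_den; exact: Du.
by apply/funext => v; rewrite row_mxEr frame_coordsE.
Qed.

Lemma ABC_manifold (M1 : topologicalType) (c1 : chart C M1) :
  hausdorff_space M1 -> countable_basis M1 -> is_chart c1 -> cdom c1 = setT ->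
  is_manifold (@holomorphic_on R) (prod_atlas [set c1] (ABC_atlas R)) (cdim c1 + 4).
Proof.
move=> h1 b1 ch1 d1; apply: prod_manifold => //.
- exact: ABC_hausdorff.
- exact: ABC_countable_basis.
- move=> c /ABC_atlasP[F _ ->]; split=> //; exact: frame_chart_is_chart.
- move=> p; have [X Xp] := bc_class_surj p.
  have [F FF u] := frames_cover (set_valP X).
  exists (frame_chart F); first by apply/ABC_atlasP; exists F.
  by rewrite -Xp; apply/(frame_chart_domP F (represents_class X)).
- move=> c c' /ABC_atlasP[F _ ->] /ABC_atlasP[F' _ ->].
  exists (fun v => frame_coords F' (par F v)).
    move=> D DP; apply: holomorphic_transition => w /DP; exact: frame_transition_minor.
  move=> p; exact: frame_transition.
Qed.

End Holomorphic.

Section RealAnalytic.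
Variable R : realType.
Local Notation C := (Cplx R).
Implicit Types F : frame R.

Lemma polyfun_analytic n (f : 'rV[R]_n -> R) a : polyfun f -> real_analytic_at f a.
Proof.
move=> pf; rewrite (_ : f = fun x => f x / 1).
  by apply: polyfun_div_analytic; [exact: pf|exact: polyfun_cst|exact: oner_neq0].
by apply/funext => x; rewrite divr1.
Qed.

Lemma emb_polyfun n (v : 'rV[R]_n -> 'rV[R]_4) :
  (forall j, polyfun (fun w => v w 0 j)) ->
  mxfun (@cpolyfun R n) (fun w => emb (v w)).
Proof.
move=> pv i j; pose f (k : nat) (w : 'rV[R]_n) : C := [:: toC (v w 0 0);
  Num.conj (Complex (v w 0 2) (v w 0 3) : C); Complex (v w 0 2) (v w 0 3);
  toC (v w 0 1)]`_k.
rewrite (_ : (fun _ => _) = f j); last by apply/funext => w; rewrite mxE.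
case: j => -[|[|[|[|//]]]] h; rewrite /f /=; split=> //=; try exact: polyfun_cst.
rewrite (_ : (fun _ => _) = fun w => (-1) * v w 0 3).
  by apply: polyfunM => //; exact: polyfun_cst.
by apply/funext => w; rewrite mulN1r.
Qed.

Lemma analytic_transition n F F' (D : set 'rV[R]_(n + 4)) :
  (forall w, D w -> minor F' (par F (emb (rsubmx w))) \in unitmx) ->
  real_analytic_on D (fun w : 'rV[R]_(n + 4) =>
    row_mx (lsubmx w) (proj (frame_coords F' (par F (emb (rsubmx w)))))).
Proof.
move=> Du w Dw j; case: (splitP j) => k jk.
  have -> : j = lshift 4 k by exact: val_inj.
  apply: polyfun_analytic.
  rewrite (_ : (fun _ => _) = fun w : 'rV[R]_(n + 4) => w 0 (lshift 4 k)).
    exact: polyfun_coord.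
  by apply/funext => v; rewrite row_mxEl mxE.
have -> : j = rshift n k by exact: val_inj.
have FR := @fun_ring_cpolyfun R (n + 4).
have PA : mxfun (@cpolyfun R (n + 4))
    (fun w : 'rV[R]_(n + 4) => par F (emb (rsubmx w))).
  apply: (mxfun_par FR); apply: emb_polyfun => i.
  rewrite (_ : (fun _ => _) = fun w : 'rV[R]_(n + 4) => w 0 (rshift n i)).
    exact: polyfun_coord.
  by apply/funext => v; rewrite mxE.
have d0 : den F' (par F (emb (rsubmx w))) != 0 by rewrite -minor_den; exact: Du.
have an (i : 'I_4) :
    real_analytic_at (fun w : 'rV[R]_(n + 4) =>
      reC (frame_coords F' (par F (emb (rsubmx w))) 0 i)) w /\
    real_analytic_at (fun w : 'rV[R]_(n + 4) =>
      imC (frame_coords F' (par F (emb (rsubmx w))) 0 i)) w.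
  have cn := mxfun_num FR F' PA (if (i < 2)%N then 0 else 1)
    (if odd i then col4 F' else col3 F').
  have [ar ai] := cpolyfun_div_analytic cn (fun_den FR F' PA) d0.
  split; [move: ar|move: ai]; congr real_analytic_at; apply/funext => v;
    by rewrite frame_coordsE.
pose f (i : nat) (v : 'rV[R]_(n + 4)) : R :=
  let c := frame_coords F' (par F (emb (rsubmx v))) in
  [:: reC (c 0 0); reC (c 0 3); reC (c 0 2); imC (c 0 2)]`_i.
rewrite (_ : (fun _ => _) = f k); last first.
  by apply/funext => v; rewrite row_mxEr mxE.
case: k {jk} => -[|[|[|[|//]]]] h; rewrite /f /=;
  first [exact: (an _).1 | exact: (an _).2].
Qed.

Lemma sa_transition_minor F F' (Fsa : sa_frames F) (Fsa' : sa_frames F') v :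
  (cmap (sa_chart F) @` (cdom (sa_chart F) `&` cdom (sa_chart F'))) v ->
  minor F' (par F (emb v)) \in unitmx.
Proof.
move=> [p [dp dp'] <-]; rewrite (sa_chartE Fsa p).2 //.
have [X Xp] := bc_class_surj (val p).
have pX : represents (val p) (val X) by exists X.
have u := (sa_chart_domP Fsa pX).1 dp; have u' := (sa_chart_domP Fsa' pX).1 dp'.
rewrite (frame_chart_mapE pX u) (sa_frame_coords Fsa pX u).
exact/(sa_chart_domP Fsa' (represents_normal_form u pX)).
Qed.

Lemma sa_transition F F' (Fsa : sa_frames F) (Fsa' : sa_frames F') p :
  cdom (sa_chart F) p -> cdom (sa_chart F') p ->
  proj (frame_coords F' (par F (emb (cmap (sa_chart F) p)))) = cmap (sa_chart F') p.
Proof.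
have [X Xp] := bc_class_surj (val p).
have pX : represents (val p) (val X) by exists X.
move=> /(sa_chart_domP Fsa pX) u; rewrite (sa_chart_mapE Fsa pX u).
rewrite (sa_frame_coords Fsa pX u).
have pY := represents_normal_form u pX.
by move=> /(sa_chart_domP Fsa' pY) u'; rewrite (sa_chart_mapE Fsa' pY u').
Qed.

Lemma BBC_manifold (M1 : topologicalType) (c1 : chart R M1) :
  hausdorff_space M1 -> countable_basis M1 -> is_chart c1 -> cdom c1 = setT ->
  is_manifold (@real_analytic_on R) (prod_atlas [set c1] (BBC_atlas R)) (cdim c1 + 4).
Proof.
move=> h1 b1 ch1 d1; apply: prod_manifold => //.
- apply: (@hausdorff_inj _ _ (val : BBC R -> ABC R)).
  + exact: initial_continuous.
  + exact: val_inj.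
  + exact: ABC_hausdorff.
- exact/countable_basis_sub/ABC_countable_basis.
- move=> c /BBC_atlasP[F Fsa ->]; split=> //; exact: sa_chart_is_chart.
- move=> p; have [X Xp [F Fsa u]] := BBC_rank2 p.
  exists (sa_chart F); first by apply/BBC_atlasP; exists F.
  by apply/(sa_chart_domP Fsa (X := val X)) => //; exists X.
- move=> c c' /BBC_atlasP[F Fsa ->] /BBC_atlasP[F' Fsa' ->].
  exists (fun v => proj (frame_coords F' (par F (emb v)))).
    move=> D DP; apply: analytic_transition => w /DP; exact: sa_transition_minor.
  move=> p; exact: sa_transition.
Qed.

End RealAnalytic.

(** * Connected components *)

Section ComplexConnected.
Variables (R : realType) (N : nat).
Local Notation C := (Cplx R).
Local Notation M24 := 'M[C]_(2, 2 + 2).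
Local Notation toC := (@toC R).

Lemma toC0 : toC 0 = 0. Proof. by []. Qed.
Lemma toC1 : toC 1 = 1. Proof. by []. Qed.

Lemma frame_class_coords (F : frame R) (X : rank2 R) : minor F (val X) \in unitmx ->
  frame_class F (frame_coords F (val X)) = bc_class X.
Proof.
move=> u; have [Y YE <-] := represents_normal_form u (represents_class X).
by congr bc_class; apply: val_inj.
Qed.

(** All the charts of the Grassmannian are images of a complex vector space and
    contain the class of one matrix with no vanishing minor. *)
Lemma ABC_joined (p q : ABC R) : joined p q.
Proof.
(* Its minors, in the order of the charts, are 1, 1, -1, -1, -1, -2. *)
pose X : M24 := mx24 [:: 1; 0; 1; 1] [:: 0; 1; 1; -1].
have Xu F : frames F -> minor F X \in unitmx.
  rewrite minor_den denE => -[[[[[]|]|]|]|] ->; rewrite !mxE /=.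
  1-5: by rewrite ?(mul1r, mulr1, mul0r, mulr0, subr0, sub0r) ?oppr_eq0 oner_eq0.
  by rewrite !mul1r -opprD oppr_eq0 (pnatr_eq0 C 2).
have rX : rank2 R X by apply: (@pair_cols_rank2 _ _ _ X (Xu (frame12 R) _)); do 5 left.
pose X0 : rank2 R := SigSub (mem_set rX); pose p0 := bc_class X0.
suff p0j r : joined p0 r by exact: joined_trans (joined_sym (p0j p)) (p0j q).
have [Y <-] := bc_class_surj r; have [F FF u] := frames_cover (set_valP Y).
rewrite -(frame_class_coords u) /p0 -(@frame_class_coords F X0 (Xu _ FF)).
apply: joined_image; first exact: frame_class_continuous.
exact: (joinedT_segment _ _ (@toC_continuous R) toC0 toC1).
Qed.

Lemma sa_class_coords (F : frame R) (Fsa : sa_frames F) (p : BBC R) (X : rank2 R) :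
  bc_class X = val p -> minor F (val X) \in unitmx ->
  sa_class Fsa (proj (frame_coords F (val X))) = p.
Proof.
move=> Xp u; have pX : represents (val p) (val X) by exists X.
apply: val_inj; rewrite /= (sa_frame_coords Fsa pX u) -Xp.
exact: frame_class_coords.
Qed.

(** As in the complex case: the four charts are images of [R^4] and share the
    class with parameters [a = b = 1] and [z = 0] of the first one. *)
Lemma BBC_joined (p q : BBC R) : joined p q.
Proof.
have F13 : sa_frames (frame13 R) by do 3 left.
pose v0 : 'rV[R]_4 := \row_j (if (j < 2)%N then 1 else 0).
pose p0 := sa_class F13 v0; pose X := par (frame13 R) (emb v0).
have rX : rank2 R X by exact: par_rank2.
have XE : X = mx24 [:: 1; 1; 0; 0] [:: 0; 0; -1; 1].
  apply/matrixP => -[[|[|//]] hr] [[|[|[|[|//]]]] hc]; rewrite !mxE /= ?mxE //=.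
  by rewrite conjCE /= oppr0.
have Xu F : sa_frames F -> minor F X \in unitmx.
  rewrite minor_den denE XE => -[[[]|]|] ->; rewrite !mxE /=;
    by rewrite ?(mul1r, mulr1, mul0r, mulr0, subr0, sub0r) ?oppr_eq0 oner_eq0.
suff p0j r : joined p0 r by exact: joined_trans (joined_sym (p0j p)) (p0j q).
have [Y Yr [F Fsa u]] := BBC_rank2 r.
rewrite -(sa_class_coords Fsa Yr u).
rewrite -(@sa_class_coords F Fsa p0 (SigSub (mem_set rX)) _ (Xu _ Fsa)) //; last first.
  by rewrite /p0 /= /frame_class; congr bc_class; apply: val_inj.
apply: joined_image; first exact: sa_class_continuous.
by apply: (@joinedT_segment R R id) => // x; exact: cvg_id.
Qed.

Lemma OmegaCP (p : triple C N) : OmegaC R N p <->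
  (forall i, p.1.1 0 i != 0) /\ (forall i, p.2 0 i != 0).
Proof. by rewrite /OmegaC /= inv_rowP. Qed.

Definition one_triple (K : pzRingType) : triple K N := (const_mx 1, 0, const_mx 1).

Lemma OmegaC1 : OmegaC R N (one_triple C).
Proof. by apply/OmegaCP; split=> i; rewrite mxE oner_neq0. Qed.

Lemma open_OmegaC : open (OmegaC R N).
Proof.
rewrite openE => p /OmegaCP[p1 p3].
have n1 : \forall t \near p, forall i, (t : triple C N).1.1 0 i != 0.
  have ni i := near_neq0 (@triple_coord1 C N i p) (p1 i).
  exact: filter_forall ni.
have n3 : \forall t \near p, forall i, (t : triple C N).2 0 i != 0.
  have ni i := near_neq0 (@triple_coord3 C N i p) (p3 i).
  exact: filter_forall ni.
by apply: filterS2 n1 n3 => t t1 t3; apply/OmegaCP.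
Qed.

(** A nonzero complex number is joined to [1] through [1] itself, or through
    [i] on the negative half-line, by segments that avoid [0]. *)
Definition midpoint (z : C) : C :=
  if (imC z == 0) && (reC z < 0) then Complex 0 1 else 1.

Lemma C_neq0 (z : C) : (z != 0) = (reC z != 0) || (imC z != 0).
Proof.
case: z => a b; rewrite -negb_and; congr negb.
by apply/eqP/andP => [[-> ->]|[/= /eqP-> /eqP->]].
Qed.

Lemma segment_to_midpoint z t : z != 0 -> 0 <= t <= 1 ->
  z + toC t * (midpoint z - z) != 0.
Proof.
move=> z0 /andP[t0 t1]; rewrite C_neq0 reCD imCD reCM imCM reCB imCB /midpoint.
rewrite C_neq0 in z0.
case: ifPn => [/andP[/eqP iz rz]|]; rewrite /= !mul0r ?subr0 ?addr0.
  have [->|t00] := eqVneq t 0; first by rewrite !mul0r !addr0.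
  by apply/orP; right; rewrite iz subr0 add0r mulr1.
rewrite negb_and -leNgt sub0r => izrz.
have [->|t11] := eqVneq t 1.
  by rewrite !mul1r addrC subrK oner_neq0.
have t1' : 0 < 1 - t by rewrite subr_gt0 lt_neqAle t11.
have [iz|iz] := eqVneq (imC z) 0.
  rewrite iz eqxx orbF in z0; rewrite iz eqxx /= in izrz.
  have rz : 0 < reC z by rewrite lt_neqAle eq_sym z0.
  apply/orP; left; rewrite gt_eqF // (_ : _ + _ = (1 - t) * reC z + t); last by ring.
  by rewrite ltr_wpDr // mulr_gt0.
apply/orP; right; rewrite (_ : _ + _ = (1 - t) * imC z); last by ring.
by rewrite mulf_neq0 // gt_eqF.
Qed.

Lemma segment_from_midpoint z t : 0 <= t <= 1 ->
  midpoint z + toC t * (1 - midpoint z) != 0.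
Proof.
move=> /andP[t0 t1]; rewrite /midpoint; case: ifP => _; last first.
  by rewrite subrr mulr0 addr0 oner_neq0.
rewrite C_neq0 reCD imCD reCM imCM reCB imCB /= !mul0r subr0 addr0 subr0 mulr1 add0r.
by have [->|//] := eqVneq t 0; rewrite mul0r addr0 oner_neq0 orbT.
Qed.

Lemma midpoint_neq0 z : midpoint z != 0.
Proof.
rewrite /midpoint; case: ifP => _; last exact: oner_neq0.
by rewrite C_neq0 /= oner_neq0 orbT.
Qed.

Lemma OmegaC_joined (p : OmegaC R N) :
  joined p (SigSub (mem_set OmegaC1) : OmegaC R N).
Proof.
pose m : triple C N :=
  (map_mx midpoint (val p).1.1, 0, map_mx midpoint (val p).2).
have Om : OmegaC R N m by apply/OmegaCP; split=> i; rewrite mxE midpoint_neq0.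
have [p1 p3] := (OmegaCP _).1 (set_valP p).
pose m0 : OmegaC R N := SigSub (mem_set Om); apply: (@joined_trans _ m0).
  apply: (joined_segment (@toC_continuous R) toC0 toC1) => t t01.
  apply/OmegaCP; split=> i; rewrite /= !mxE; exact: segment_to_midpoint.
apply: (joined_segment (@toC_continuous R) toC0 toC1) => t t01.
apply/OmegaCP; split=> i; rewrite /= !mxE; exact: segment_from_midpoint.
Qed.

Lemma problems_connected : connected [set: problems R N].
Proof.
pose p0 : problems R N :=
  (SigSub (mem_set OmegaC1) : OmegaC R N, frame_class (frame12 R) 0).
suff p0j p : joined p0 p by exact: connectedT_joined p0j.
case: p => p q.
by apply: joined_pair; [exact/joined_sym/OmegaC_joined | exact: ABC_joined].
Qed.

Lemma problems_complex_manifold : complex_manifold (problems_atlas R N) (3 * N + 5)%N.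
Proof.
have -> : (3 * N + 5)%N = (cdim (Omega_chart (OmegaC R N)) + 4)%N by rewrite /=; lia.
apply: ABC_manifold => //.
- apply: (@hausdorff_inj _ _ (val : OmegaC R N -> triple C N)).
  + exact: initial_continuous.
  + exact: val_inj.
  + exact: norm_hausdorff.
- apply: countable_basis_sub; apply: countable_basis_prod.
    by apply: countable_basis_prod; exact/countable_basis_mx/countable_basisC.
  exact/countable_basis_mx/countable_basisC.
- apply: Omega_chart_is_chart; first exact: open_OmegaC.
  by exists (one_triple C); exact: OmegaC1.
Qed.

End ComplexConnected.

Section RealComponents.
Variables (R : realType) (N : nat).

Lemma OmegaRposP (p : triple R N) : OmegaRpos R N p <->
  (forall i, p.1.1 0 i != 0) /\ (forall i, 0 < p.2 0 i).
Proof. by rewrite /OmegaRpos /= inv_rowP. Qed.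

Lemma open_OmegaRpos : open (OmegaRpos R N).
Proof.
rewrite openE => p /OmegaRposP[p1 p3].
have n1 : \forall t \near p, forall i, (t : triple R N).1.1 0 i != 0.
  have ni i := near_neq0 (@triple_coord1 R N i p) (p1 i).
  exact: filter_forall ni.
have n3 : \forall t \near p, forall i, 0 < (t : triple R N).2 0 i.
  have ni i : \forall t \near p, 0 < (t : triple R N).2 0 i.
    exact: (@cvgr_gt R (triple R N) (nbhs p) _ _ _ (@triple_coord3 R N i p) 0 (p3 i)).
  exact: filter_forall ni.
by apply: filterS2 n1 n3 => t t1 t3; apply/OmegaRposP.
Qed.

Lemma convex_comb_gt0 (a b t : R) : 0 <= t <= 1 -> 0 < a -> 0 < b ->
  0 < a + t * (b - a).
Proof.
move=> /andP[t0 t1] a0 b0; have [->|t00] := eqVneq t 0; first by rewrite mul0r addr0.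
rewrite (_ : _ + _ = (1 - t) * a + t * b); last by ring.
apply: ltr_wpDl; first by rewrite mulr_ge0 ?subr_ge0 // ltW.
by rewrite mulr_gt0 // lt_neqAle eq_sym t00.
Qed.

(** The invariant that separates the connected components. *)
Definition signs (p : sa_problems R N) : {ffun 'I_N.+1 -> bool} :=
  [ffun n => 0 < (val p.1).1.1 0 n].

(** The coefficients with given signs of the [1 / f_n] form a convex set. *)
Lemma joined_signs (p q : sa_problems R N) : signs p = signs q -> joined p q.
Proof.
case: p q => [p b] [q b'] /ffunP pq; apply: joined_pair; last exact: BBC_joined.
have [p1 p3] := (OmegaRposP _).1 (set_valP p).
have [q1 q3] := (OmegaRposP _).1 (set_valP q).
apply: (@joined_segment R R id) => [x|||t t01] //.
apply/OmegaRposP; split=> i; rewrite /= !mxE; last exact: convex_comb_gt0.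
have := pq i; rewrite !ffunE /=.
have := p1 i; have := q1 i.
set a := (val p).1.1 0 i; set c := (val q).1.1 0 i => c0 a0.
case: (ltgtP 0 a) a0 => // a0 _; case: (ltgtP 0 c) c0 => // c0 _ _.
  by rewrite gt_eqF // convex_comb_gt0.
rewrite -oppr_eq0 gt_eqF // (_ : - _ = - a + t * (- c - - a)); last by ring.
by rewrite convex_comb_gt0 // oppr_gt0.
Qed.

(** A connected set has an interval as its image by [1 / f_n], and this interval
    avoids 0. *)
Lemma signs_joined (p q : sa_problems R N) : joined p q -> signs p = signs q.
Proof.
move=> [A [Ap _ cA] Aq]; apply/ffunP => n; rewrite !ffunE.
pose g (p : sa_problems R N) : R := (val p.1).1.1 0 n.
have gc : continuous g.
  move=> x; apply: (@continuous_comp _ _ _ (fun x : sa_problems R N => val x.1)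
    (fun p : triple R N => p.1.1 0 n)); last exact: triple_coord1.
  apply: (@continuous_comp _ _ _ fst (val : OmegaRpos R N -> triple R N)).
    exact: cvg_fst.
  exact: initial_continuous.
have gA : is_interval (g @` A).
  apply/connected_intervalP/connected_continuous_connected => //.
  exact: continuous_subspaceT.
have g0 x : g x != 0 by have [+ _] := (OmegaRposP _).1 (set_valP x.1); exact.
have no (x y : sa_problems R N) : A x -> A y -> 0 < g x -> 0 < g y.
  move=> Ax Ay gx; rewrite ltNge; apply/negP => gy.
  have : (g @` A) 0.
    by apply: (gA (g y) (g x)); [exists y | exists x | rewrite gy ltW].
  by move=> [z _ /eqP]; rewrite (negbTE (g0 z)).
by apply/idP/idP; exact: no.
Qed.

Lemma signs_surj (s : {ffun 'I_N.+1 -> bool}) :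
  exists p : sa_problems R N, signs p = s.
Proof.
pose w : triple R N := (\row_n (if s n then 1 else -1), 0, const_mx 1).
have Ow : OmegaRpos R N w.
  apply/OmegaRposP; split=> i; rewrite mxE //.
  by case: ifP => _; rewrite ?oppr_eq0 oner_neq0.
have F13 : sa_frames (frame13 R) by do 3 left.
exists (SigSub (mem_set Ow), sa_class F13 0); apply/ffunP => n.
by rewrite ffunE /= mxE; case: (s n); rewrite ?ltr01 // ltr0N1.
Qed.

Lemma sa_problems_components :
  (components (sa_problems R N) #= `I_(2 ^ N.+1)%N)%card.
Proof.
have /choice[pt ptE] := signs_surj.
pose T : finType := {ffun 'I_N.+1 -> bool}.
pose f (i : 'I_#|T|) := connected_component [set: sa_problems R N] (pt (enum_val i)).
have fI : injective f.
  move=> i j fij; apply: enum_val_inj; rewrite -(ptE (enum_val i)) -(ptE (enum_val j)).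
  apply: signs_joined; rewrite /joined -/(f i) fij.
  exact: connected_component_refl.
have -> : components (sa_problems R N) = range f.
  apply/seteqP; split=> [_ [p _ <-]|_ [i _ <-]]; last by exists (pt (enum_val i)).
  exists (enum_rank (signs p)) => //; rewrite /f enum_rankK.
  by apply: same_connected_component; apply: joined_signs; rewrite ptE.
have -> : (2 ^ N.+1)%N = #|T| by rewrite card_ffun card_bool card_ord.
apply: (@card_eq_trans _ _ _ _ [set: 'I_#|T|]).
  by apply: inj_card_eq => i j _ _; exact: fI.
by rewrite card_eq_sym; exact: card_II.
Qed.

Lemma sa_problems_manifold :
  real_analytic_manifold (sa_problems_atlas R N) (3 * N + 5)%N.
Proof.
have -> : (3 * N + 5)%N = (cdim (Omega_chart (OmegaRpos R N)) + 4)%N by rewrite /=; lia.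
apply: BBC_manifold => //.
- apply: (@hausdorff_inj _ _ (val : OmegaRpos R N -> triple R N)).
  + exact: initial_continuous.
  + exact: val_inj.
  + exact: norm_hausdorff.
- apply: countable_basis_sub; apply: countable_basis_prod.
    by apply: countable_basis_prod; exact/countable_basis_mx/countable_basisR.
  exact/countable_basis_mx/countable_basisR.
- apply: Omega_chart_is_chart; first exact: open_OmegaRpos.
  exists (one_triple N R); apply/OmegaRposP.
  by split=> i; rewrite mxE ?oner_neq0.
Qed.

End RealComponents.

Theorem theorem2p3 (R : realType) (N : nat) (hN : (2 <= N)%N) :
  [/\ connected [set: problems R N],
      complex_manifold (problems_atlas R N) (3 * N + 5)%N,
      real_analytic_manifold (sa_problems_atlas R N) (3 * N + 5)%N
    & (components (sa_problems R N) #= `I_(2 ^ N.+1)%N)%card].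
Proof.
split.
- exact: problems_connected.
- exact: problems_complex_manifold.
- exact: sa_problems_manifold.
- exact: sa_problems_components.
Qed.
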